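(* Let $\Omega\subseteq\mathbb{R}^d$ and let $M_i=(\Omega,P_i)$, $i\in[L]=\{1,\dots,L\}$, be reversible Markov chains with stationary distributions $p_i$ (with densities, also denoted $p_i$). Let $r_1,\dots,r_L>0$ with $\sum_i r_i=1$, let $r=\min_i r_i/\max_i r_i$, and let $M_{\mathrm{st}}$ be the simulated tempering chain built from $(M_i)$ and $(r_i)$. For each $i\in[L]$ let $\mathcal P_i$ be a finite partition of $\Omega$ into measurable sets (overlaps of measure zero allowed) with $p_i(A)>0$ for all $A\in\mathcal P_i$, and with $\mathcal P_1=\{\Omega\}$. Let $$\delta=\min_{1<i\le L,\ A\in\mathcal P_i}\frac{\int_A\min\{p_{i-1}(x),p_i(x)\}\,dx}{p_i(A)},\qquad p_{\min}=\min_{i\in[L],\,A\in\mathcal P_i}p_i(A).$$ Then $$\operatorname{Gap}(M_{\mathrm{st}})\ \ge\ \frac{r^4\delta^2p_{\min}^2}{32L^4}\min_{1\le i\le L,\ A\in\mathcal P_i}\operatorname{Gap}(M_i|_A).$$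
   Context: A (discrete-time) Markov chain $M=(\Omega,P)$ has transition kernel $P(x,\cdot)$; $p$ is stationary if $\int p(x)P(x,\cdot)dx=p$, and $M$ is reversible if $p(x)P(x,dy)=p(y)P(y,dx)$. For $g\in L^2(p)$, $(Pg)(x)=\int g(y)P(x,dy)$, $\langle g,h\rangle_p=\int gh\,p$, the Dirichlet form is $\mathcal E_M(g)=\langle g,(I-P)g\rangle_p$, $\operatorname{Var}_p(g)=\|g-\int gp\|_p^2$, and the spectral gap is $\operatorname{Gap}(M)=\inf\{\mathcal E_M(g)/\operatorname{Var}_p(g): g\in L^2(p),\ \operatorname{Var}_p(g)>0\}$. Restriction: for measurable $A\subseteq\Omega$, $M|_A=(A,P|_A)$ with $P|_A(x,B)=P(x,B)+\mathbf 1_B(x)P(x,A^c)$ for $x\in A$, $B\subseteq A$ (proposed moves leaving $A$ are rejected); its stationary distribution is $p$ conditioned on $A$. Simulated tempering chain: state space $\Omega\times[L]$. From state $(x,k)$: with probability $1/2$ (Type 1) keep $k$ and move $x$ according to $P_k$; with probability $1/2$ (Type 2) draw $k'$ uniformly from $[L]$ and move to $(x,k')$ with probability $\min\{\frac{r_{k'}p_{k'}(x)}{r_kp_k(x)},1\}$, otherwise stay. Its stationary distribution is $p(x,i)=r_ip_i(x)$. *)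

(* Defs.v *)
From HB Require Import structures.
From mathcomp Require Import all_boot all_order all_algebra.
From mathcomp Require Import all_classical all_reals all_analysis.

Set Implicit Arguments.
Unset Strict Implicit.
Unset Printing Implicit Defensive.
Import Order.TTheory GRing.Theory Num.Theory.

Local Open Scope classical_set_scope.
Local Open Scope ring_scope.

Section Defs.
Context {R : realType} {d : measure_display} {T : measurableType d}.
Variable mu : {measure set T -> \bar R}.  (* reference measure ("dx") *)

(* the reference measure has no atoms (true for Lebesgue measure on Omega) *)
Definition atomless : Prop :=
  forall A : set T, measurable A -> (0 < mu A)%E ->
    exists B : set T, [/\ measurable B, B `<=` A, (0 < mu B)%E & (mu B < mu A)%E].

Definition is_density (p : T -> R) : Prop :=
  [/\ forall x, 0 <= p x, measurable_fun [set: T] p &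
      (\int[mu]_x (p x)%:E = 1)%E].

Definition pmass (p : T -> R) (A : set T) : R :=
  fine (\int[mu]_(x in A) (p x)%:E)%E.

Definition stationary (p : T -> R) (P : R.-pker T ~> T) : Prop :=
  forall B : set T, measurable B ->
    (\int[mu]_x ((p x)%:E * P x B) = \int[mu]_(x in B) (p x)%:E)%E.

Definition reversible (p : T -> R) (P : R.-pker T ~> T) : Prop :=
  forall A B : set T, measurable A -> measurable B ->
    (\int[mu]_(x in A) ((p x)%:E * P x B) = \int[mu]_(x in B) ((p x)%:E * P x A))%E.

Definition restr_op (P : R.-pker T ~> T) (A : set T) (g : T -> R) (x : T) : R :=
  fine (\int[P x]_(y in A) (g y)%:E)%E + g x * fine (P x (~` A)).

(* Spectral gap of the restricted chain M|_A = (A, P|_A), whose stationary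
   distribution is p conditioned on A, i.e. density p / p(A) on A. *)
Section Restricted.
Variables (p : T -> R) (P : R.-pker T ~> T) (A : set T).

Definition inL2A (g : T -> R) : Prop :=
  measurable_fun A g /\ (\int[mu]_(x in A) (p x * g x ^+ 2)%:E < +oo)%E.

Definition meanA (g : T -> R) : R := pmass (fun x => p x * g x) A / pmass p A.

Definition varA (g : T -> R) : R :=
  pmass (fun x => p x * (g x - meanA g) ^+ 2) A / pmass p A.

Definition dirichletA (g : T -> R) : R :=
  pmass (fun x => p x * (g x * (g x - restr_op P A g x))) A / pmass p A.

Definition gap_restr : \bar R :=
  ereal_inf [set ((dirichletA g / varA g)%:E) | g in
               [set g | inL2A g /\ 0 < varA g]].
End Restricted.

(* Simulated tempering chain on T x [L] (levels indexed 0..L-1), built from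
   kernels P k, densities p k and weights r k.  Functions on the product
   space are written g k x. *)
Section Tempering.
Variables (L : nat) (r : nat -> R) (p : nat -> T -> R) (P : nat -> R.-pker T ~> T).

Definition accept (k k' : nat) (x : T) : R :=
  Num.min ((r k' * p k' x) / (r k * p k x)) 1.

Definition st_op (g : nat -> T -> R) (k : nat) (x : T) : R :=
  2^-1 * fine (\int[P k x]_y (g k y)%:E)%E +
  2^-1 * (L%:R^-1 * \sum_(k' < L)
            (accept k k' x * g k' x + (1 - accept k k' x) * g k x)).

Definition inL2st (g : nat -> T -> R) : Prop :=
  forall k, (k < L)%N ->
    measurable_fun [set: T] (g k) /\
    (\int[mu]_x (p k x * g k x ^+ 2)%:E < +oo)%E.

(* integral against the stationary distribution r_k p_k(x) dx *)
Definition st_int (h : nat -> T -> R) : R :=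
  \sum_(k < L) r k * pmass (fun x => p k x * h k x) [set: T].

Definition st_mean (g : nat -> T -> R) : R := st_int g.

Definition st_var (g : nat -> T -> R) : R :=
  st_int (fun k x => (g k x - st_mean g) ^+ 2).

Definition st_dirichlet (g : nat -> T -> R) : R :=
  st_int (fun k x => g k x * (g k x - st_op g k x)).

Definition gap_st : \bar R :=
  ereal_inf [set ((st_dirichlet g / st_var g)%:E) | g in
               [set g | inL2st g /\ 0 < st_var g]].
End Tempering.

Definition is_partition (s : seq (set T)) : Prop :=
  [/\ forall j, (j < size s)%N -> measurable (nth set0 s j),
      \big[setU/set0]_(A <- s) A = [set: T] &
      forall j k, (j < size s)%N -> (k < size s)%N -> j <> k ->
        mu (nth set0 s j `&` nth set0 s k) = 0%E].

End Defs.

(* Main.v *)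
Require Import Defs.
From HB Require Import structures.
From mathcomp Require Import all_boot all_order all_algebra.
From mathcomp Require Import all_classical all_reals all_analysis.
From mathcomp Require Import measurable_realfun.
From mathcomp Require Import ring lra.
Import Order.TTheory GRing.Theory Num.Theory.
Import numFieldNormedType.Exports.
Local Open Scope classical_set_scope.
Local Open Scope ring_scope.

Set Implicit Arguments.
Unset Strict Implicit.
Unset Printing Implicit Defensive.

(** Let [gamma] be the least gap of the restricted chains. Reversibility turns a
    Dirichlet form into half the integral of [(g x - g y)^2], so that the form
    of level [i] dominates the sum of the forms restricted to its blocks, and
    hence [gamma] times the total within-block variance [v i]. The Metropolis
    moves between levels contribute the integrals [t i] of
    [min(p_(i-1), p_i) (g_i - g_(i-1))^2].

    Every block [A] of level [i+1] has overlap at least [delta * pmin^2] with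
    some block [B] of level [i], so that the block means [m A] and [m B] satisfy
    [(m A - m B)^2 <= 3 / (delta pmin^2) * (v (i+1) + t (i+1) + v i)]. Following
    these links down to the single block of the bottom level, Cauchy-Schwarz
    bounds the deviation of every block mean from the mean of the bottom level,
    and therefore the variance of [g]. The atomless reference measure provides an
    indicator function showing [gamma <= 2], which lets the terms [t i] be
    absorbed into a multiple of [1 / gamma]. *)

(** * Partitions with null overlaps *)

Section AePartition.
Context {R : realType} {d : measure_display} {T : measurableType d}.
Variable mu : {measure set T -> \bar R}.

(** The union splits disjointly into [A] and the part of [B] outside [A], which differs from [B]
    only by the null overlap. *)
Lemma ge0_integral_setU_null (A B : set T) (f : T -> \bar R) :
  measurable A -> measurable B -> measurable_fun [set: T] f ->
  (forall x, 0 <= f x)%E -> mu (A `&` B) = 0%E ->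
  (\int[mu]_(x in A `|` B) f x =
   \int[mu]_(x in A) f x + \int[mu]_(x in B) f x)%E.
Proof.
move=> mA mB mf f0 AB0.
have mfD D : measurable_fun D f by exact: measurable_funTS.
have mBA : measurable (B `\` A) by exact: measurableD.
have mBiA : measurable (B `&` A) by exact: measurableI.
rewrite (_ : A `|` B = A `|` (B `\` A)); last first.
  apply/seteqP; split => x; first by case: (pselect (A x)); [left|move=> ? [|]//; right].
  by case=> [|[]]; [left|right].
rewrite ge0_integral_setU//; last by apply/disj_setPS => x [? []].
congr (_ + _)%E.
rewrite -{2}(setDUK (@subIsetl _ B A)) setDIr setDv set0U setUC.
rewrite ge0_integral_setU//; last by apply/disj_setPS => x [[_ ?] []].
by rewrite [X in (_ + X)%E]null_set_integral// ?adde0// setIC.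
Qed.

(** Induction on the number of blocks joined so far: the next block meets their union inside a
    finite union of null pairwise overlaps. *)
Lemma ge0_integral_partition (s : seq (set T)) (D : set T) (f : T -> \bar R) :
  is_partition mu s -> measurable D -> measurable_fun [set: T] f ->
  (forall x, 0 <= f x)%E ->
  (\int[mu]_(x in D) f x = \sum_(A <- s) \int[mu]_(x in D `&` A) f x)%E.
Proof.
move=> [ms cover disj] mD mf f0.
suff main n : (n <= size s)%N ->
    (\int[mu]_(x in D `&` \big[setU/set0]_(0 <= j < n) nth set0 s j) f x =
     \sum_(0 <= j < n) \int[mu]_(x in D `&` nth set0 s j) f x)%E.
  by rewrite -{1}[D]setIT -cover (big_nth set0) main// (big_nth set0).
elim: n => [_|n IH nlt]; first by rewrite !big_nil setI0 integral_set0.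
have mU : measurable (\big[setU/set0]_(0 <= j < n) nth set0 s j).
  rewrite big_nat; apply: bigsetU_measurable => j /andP[_ jn].
  exact/ms/(ltn_trans jn).
rewrite !big_nat_recr//= -IH ?(ltnW nlt)// setIUr.
apply: ge0_integral_setU_null => //; do ?[apply: measurableI => //; exact: ms].
rewrite setIACA setIid.
apply: (@subset_measure0 _ _ _ mu _
  (\bigcup_(j in `I_n) (nth set0 s j `&` nth set0 s n))).
- by apply: measurableI => //; apply: measurableI => //; exact: ms.
- apply: bigcup_measurable => j jn.
  by apply: measurableI; apply: ms => //; exact: ltn_trans nlt.
- by move=> x [_ []]; rewrite big_mkord -bigcup_mkord => -[j jn sx] sn; exists j.
- apply/negligibleP.
    apply: bigcup_measurable => j jn.
    by apply: measurableI; apply: ms => //; exact: ltn_trans nlt.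
  rewrite bigcup_mkord; apply: (big_ind (mu.-negligible)) => [|X Y|j _].
  + exact: negligible_set0.
  + exact: negligibleU.
  apply/negligibleP.
    by apply: measurableI; apply: ms => //; exact: ltn_trans nlt.
  apply: disj => //; first exact: ltn_trans nlt.
  by apply/eqP; rewrite ltn_eqF.
Qed.
End AePartition.

(** * Reversible kernels and Dirichlet forms *)

Section Reversible.
Context {R : realType} {d : measure_display} {T : measurableType d}.
Variable mu : {measure set T -> \bar R}.
Variables (p : T -> R) (P : R.-pker T ~> T).
Hypothesis p0 : forall x, 0 <= p x.
Hypothesis mp : measurable_fun [set: T] p.
Hypothesis revP : reversible mu p P.

Import HBNNSimple.

Lemma pker_le1 (x : T) (A : set T) : measurable A -> (P x A <= 1)%E.
Proof.
move=> mA; rewrite -(@prob_kernel _ _ _ _ _ P x).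
by apply: le_measure; rewrite ?inE.
Qed.

Lemma pker_fin_num (x : T) (A : set T) : measurable A -> P x A \is a fin_num.
Proof.
move=> mA; rewrite ge0_fin_numE//.
by apply: le_lt_trans (pker_le1 x mA) _; rewrite ltry.
Qed.

Lemma measurable_integral_pker (f : T -> \bar R) :
  (forall x, 0 <= f x)%E -> measurable_fun [set: T] f ->
  measurable_fun [set: T] (fun x => \int[P x]_y f y)%E.
Proof.
move=> f0 mf; apply: measurable_fun_integral_kernel => // U mU.
exact: measurable_kernel.
Qed.

Let mpE : measurable_fun [set: T] (EFin \o p).
Proof. exact/measurable_EFinP. Qed.

(** A simple function is a finite combination of indicators of its level sets, and on each level set
    the identity is [revP]. *)
Lemma reversible_integral_nnsfun (A : set T) (h : {nnsfun T >-> R}) :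
  measurable A ->
  (\int[mu]_(x in A) ((p x)%:E * \int[P x]_y (h y)%:E) =
   \int[mu]_x ((p x)%:E * P x A * (h x)%:E))%E.
Proof.
move=> mA.
have mh r : measurable (h @^-1` [set r]) by exact: measurable_funPTI.
have hE x : (h x)%:E = (\sum_(r \in range h) (r%:E * (\1_(h @^-1` [set r]) x)%:E))%E.
  by rewrite fimfunE -fsumEFin//; apply: eq_fsbigr => r _; rewrite EFinM.
have hr0 (r : R) x : (0 <= r%:E * (\1_(h @^-1` [set r]) x)%:E)%E.
  by rewrite -EFinM EFinM nnfun_muleindic_ge0.
have mhr (r : R) : measurable_fun [set: T] (fun x => r%:E * (\1_(h @^-1` [set r]) x)%:E)%E.
  by apply: measurable_funeM; apply/measurable_EFinP; exact: measurable_indic.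
have mu0 (r : R) (nu : {measure set T -> \bar R}) : (0 <= r%:E * nu (h @^-1` [set r]))%E.
  have := @mulemu_ge0 _ T R nu r (fun r => h @^-1` [set r]).
  by apply; exact: preimage_nnfun0.
have -> : (\int[mu]_(x in A) ((p x)%:E * \int[P x]_y (h y)%:E) =
    \int[mu]_(x in A) (\sum_(r \in range h) ((p x)%:E * (r%:E * P x (h @^-1` [set r])))))%E.
  apply: eq_integral => x _.
  rewrite -ge0_mule_fsumr//; congr (_ * _)%E.
  under eq_integral do rewrite hE.
  rewrite ge0_integral_fsum//; apply: eq_fsbigr => r _.
  rewrite (integralZl_indic _ (fun r => h @^-1` [set r]))//.
    by rewrite integral_indic// setIT.
  exact: preimage_nnfun0.
have -> : (\int[mu]_x ((p x)%:E * P x A * (h x)%:E) =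
    \int[mu]_x (\sum_(r \in range h)
      ((p x)%:E * P x A * (r%:E * (\1_(h @^-1` [set r]) x)%:E))))%E.
  by apply: eq_integral => x _; rewrite hE ge0_mule_fsumr.
have mPr (r : R) B : measurable B -> measurable_fun [set: T] (fun x => (p x)%:E * P x B)%E.
  move=> mB; apply: emeasurable_funM => //; exact: measurable_kernel.
rewrite !ge0_integral_fsum//; last 4 first.
- move=> r; apply: emeasurable_funM => //; exact: mPr.
- by move=> r x _; rewrite mule_ge0// mule_ge0// lee_fin.
- move=> r; apply: measurable_funTS; apply: emeasurable_funM => //.
  apply: measurable_funeM; exact: measurable_kernel.
- by move=> r x _; rewrite mule_ge0// lee_fin.
apply: eq_fsbigr => r _.
(* A negative [r] is not a value of [h], so its level set is empty and both sides vanish; a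
   nonnegative [r] can be pulled out of the integrals. *)
have [r0|r0] := leP 0 r; last first.
  rewrite preimage_nnfun0//; under eq_integral do rewrite measure0 !mule0.
  by under [RHS]eq_integral do rewrite indic0 !mule0; rewrite !integral0.
under eq_integral do rewrite muleCA.
under [RHS]eq_integral do rewrite muleCA.
rewrite !ge0_integralZl//; last 4 first.
- apply: emeasurable_funM; first exact: mPr.
  by apply/measurable_EFinP; exact: measurable_indic.
- by move=> x _; rewrite !mule_ge0// lee_fin.
- by apply: measurable_funTS; exact: mPr.
- by move=> x _; rewrite mule_ge0// lee_fin.
congr (_ * _)%E; rewrite revP// [LHS]integral_mkcond.
by apply: eq_integral => x _; rewrite epatch_indic.
Qed.

(** Monotone convergence carries the identity from the simple approximations [h n] to [f]; on the
    left it acts twice, under the kernel and then under [mu]. *)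
Lemma reversible_integral (A : set T) (f : T -> \bar R) :
  measurable A -> (forall x, 0 <= f x)%E -> measurable_fun [set: T] f ->
  (\int[mu]_(x in A) ((p x)%:E * \int[P x]_y f y) =
   \int[mu]_x ((p x)%:E * P x A * f x))%E.
Proof.
move=> mA f0 mf.
pose h := nnsfun_approx measurableT mf.
have h_cvg x : ((h n x)%:E @[n --> \oo] --> f x)%E by exact: cvg_nnsfun_approx.
have h_nd x : {homo (fun n => (h n x)%:E) : n m / (n <= m)%N >-> (n <= m)%E}.
  by move=> n m nm; rewrite lee_fin; exact/lefP/nd_nnsfun_approx.
have h0 n x : (0 <= (h n x)%:E)%E by rewrite lee_fin.
have mh n : measurable_fun [set: T] (fun x => (h n x)%:E) by exact/measurable_EFinP.
have pP0 x : (0 <= (p x)%:E * P x A)%E by rewrite mule_ge0// lee_fin.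
have mpP : measurable_fun [set: T] (fun x => (p x)%:E * P x A)%E.
  by apply: emeasurable_funM => //; exact: measurable_kernel.
have intP_ge0 n x : (0 <= \int[P x]_y (h n y)%:E)%E.
  by apply: integral_ge0 => y _.
have intP_nd x : {homo (fun n => \int[P x]_y (h n y)%:E)%E : n m / (n <= m)%N >-> (n <= m)%E}.
  by move=> n m nm; apply: ge0_le_integral => // y _; exact: h_nd.
have intP_lim x : ((\int[P x]_y (h n y)%:E) @[n --> \oo] --> \int[P x]_y f y)%E.
  have := @cvg_monotone_convergence _ _ _ (P x) _ measurableT _ mh
    (fun n x _ => h0 n x) (fun x _ => h_nd x).
  congr (_ --> _); apply: eq_integral => y _; apply/cvg_lim => //; exact: h_cvg.
have fin_pP x : ((p x)%:E * P x A)%E \is a fin_num.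
  by rewrite fin_numM// pker_fin_num.
transitivity (limn (fun n => \int[mu]_(x in A) ((p x)%:E * \int[P x]_y (h n y)%:E)))%E.
  rewrite -monotone_convergence//.
  - apply: eq_integral => x _; apply/esym/cvg_lim => //; exact: cvgeZl.
  - move=> n; apply: measurable_funTS; apply: emeasurable_funM => //.
    exact: measurable_integral_pker.
  - by move=> n x _; rewrite mule_ge0// lee_fin.
  - by move=> x _ n m nm; apply: lee_wpmul2l; rewrite ?lee_fin//; exact: intP_nd.
under eq_fun do rewrite reversible_integral_nnsfun//.
rewrite -monotone_convergence//.
- apply: eq_integral => x _; apply/cvg_lim => //; exact: cvgeZl.
- by move=> n; exact: emeasurable_funM.
- by move=> n x _; rewrite mule_ge0// lee_fin.
- by move=> x _ n m nm; apply: lee_wpmul2l => //; exact: h_nd.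
Qed.
End Reversible.

(** * The Dirichlet form as an integral of squared differences *)

Section Dirichlet.
Context {R : realType} {d : measure_display} {T : measurableType d}.
Variable mu : {measure set T -> \bar R}.
Variables (p : T -> R) (P : R.-pker T ~> T).
Hypothesis p0 : forall x, 0 <= p x.
Hypothesis mp : measurable_fun [set: T] p.
Hypothesis revP : reversible mu p P.
Variables (g : T -> R) (A : set T).
Hypothesis mg : measurable_fun [set: T] g.
Hypothesis g2 : (\int[mu]_x (p x * g x ^+ 2)%:E < +oo)%E.
Hypothesis mA : measurable A.

Let a x := fine (P x A).
Let G1 x := fine (\int[P x]_(y in A) (g y)%:E)%E.
Let G2 x := (\int[P x]_(y in A) (g y ^+ 2)%:E)%E.
Let H x := (\int[P x]_(y in A) ((g x - g y) ^+ 2)%:E)%E.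

Let aE x : P x A = (a x)%:E.
Proof. by rewrite fineK// pker_fin_num. Qed.

Let a_ge0 x : 0 <= a x.
Proof. exact: fine_ge0. Qed.

Let a_le1 x : a x <= 1.
Proof. by rewrite -lee_fin -aE pker_le1. Qed.

Let pg_ge0 x : 0 <= p x * g x ^+ 2.
Proof. exact: mulr_ge0 (p0 x) (sqr_ge0 _). Qed.

Let pag_ge0 x : 0 <= p x * (a x * g x ^+ 2).
Proof. exact: mulr_ge0 (p0 x) (mulr_ge0 (a_ge0 x) (sqr_ge0 _)). Qed.

Let aC x : fine (P x (~` A)) = 1 - a x.
Proof.
have mCA := measurableC mA.
have /(congr1 fine) : (P x A + P x (~` A) = 1)%E.
  rewrite -measureU//; last exact: setICr.
  by rewrite setUv; exact: prob_kernel.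
by rewrite fineD ?pker_fin_num//= -/(a x) => <-; rewrite addrC addKr.
Qed.

Let mG2 : measurable_fun [set: T] G2.
Proof.
rewrite /G2; under eq_fun do rewrite integral_mkcond.
apply: measurable_integral_pker.
  by move=> x; apply: erestrict_ge0 => y _; rewrite lee_fin sqr_ge0.
apply/(measurable_restrictT _ _).1 => //; apply: measurable_funTS.
by apply/measurable_EFinP; exact: measurable_funX.
Qed.

Let mgA : measurable_fun [set: T] ((EFin \o g) \_ A).
Proof.
by apply/(measurable_restrictT _ _).1 => //; apply: measurable_funTS; exact/measurable_EFinP.
Qed.

Let mG1 : measurable_fun [set: T] G1.
Proof.
apply: measurableT_comp => //.
under eq_fun do rewrite integral_mkcond integralE.
by apply: emeasurable_funB; apply: measurable_integral_pker => //;
  [exact: measurable_funepos|exact: measurable_funeneg].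
Qed.

(** The integrand depends on both [x] and [y], so measurability comes from the joint function [k] on
    [T * T], with the domain [A] moved into an indicator. *)
Lemma measurable_integral_sqB : measurable_fun [set: T] H.
Proof.
rewrite /H; under eq_fun do rewrite integral_mkcond.
pose k (z : T * T) := (((g z.1 - g z.2) ^+ 2)%:E * (\1_A z.2)%:E)%E.
have -> : (fun x => \int[P x]_y ((fun y => ((g x - g y) ^+ 2)%:E) \_ A) y)%E =
          (fun x => \int[P x]_y k (x, y))%E.
  by apply/funext => x; apply: eq_integral => y _; rewrite epatch_indic.
apply: measurable_fun_integral_finite_kernel.
  by move=> z; rewrite /k -EFinM lee_fin mulr_ge0 ?sqr_ge0//.
apply: emeasurable_funM; apply/measurable_EFinP.
  apply: measurable_funX; apply: measurable_funB.
    exact: measurableT_comp.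
  exact: measurableT_comp.
by apply: measurableT_comp => //; exact: measurable_indic.
Qed.

Let ma : measurable_fun [set: T] a.
Proof. by apply: measurableT_comp => //; exact: measurable_kernel. Qed.

Let mpg2 : measurable_fun [set: T] (fun x => p x * g x ^+ 2).
Proof. by apply: measurable_funM => //; exact: measurable_funX. Qed.

Lemma integrable_density_sq D : measurable D ->
  mu.-integrable D (fun x => (p x * g x ^+ 2)%:E).
Proof.
move=> mD; apply: (@integrableS _ _ _ mu setT) => //.
apply/integrableP; split; first exact/measurable_EFinP.
rewrite (eq_integral (fun x => (p x * g x ^+ 2)%:E))// => x _.
by rewrite gee0_abs// lee_fin.
Qed.

Let int_pag2 : mu.-integrable A (fun x => (p x * (a x * g x ^+ 2))%:E).
Proof.
apply: (le_integrable _ _ _ (integrable_density_sq mA)) => //.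
  apply: measurable_funTS; apply/measurable_EFinP; apply: measurable_funM => //.
  by apply: measurable_funM => //; exact: measurable_funX.
move=> x _; rewrite !gee0_abs ?lee_fin//.
by rewrite ler_wpM2l// ler_piMl ?sqr_ge0//.
Qed.

(** Reversibility exchanges the two endpoints of a move inside [A], so [g ^+ 2] has the same average
    at the end as at the start. This makes [p * G2] integrable. *)
Let int_pG2E : (\int[mu]_(x in A) ((p x)%:E * G2 x) =
  \int[mu]_(x in A) (p x * (a x * g x ^+ 2))%:E)%E.
Proof.
rewrite /G2; under eq_integral do rewrite integral_mkcond.
rewrite (reversible_integral p0)//; last 2 first.
- by move=> x; apply: erestrict_ge0 => y _; rewrite lee_fin sqr_ge0.
- apply/(measurable_restrictT _ _).1 => //; apply: measurable_funTS.
  by apply/measurable_EFinP; exact: measurable_funX.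
rewrite [RHS]integral_mkcond; apply: eq_integral => x _.
rewrite !epatch_indic/= aE muleA; congr (_ * _)%E.
by rewrite -!EFinM !mulrA.
Qed.

Let G2_ge0 x : (0 <= G2 x)%E.
Proof. by apply: integral_ge0 => y _; rewrite lee_fin sqr_ge0. Qed.

Let H_ge0 x : (0 <= H x)%E.
Proof. by apply: integral_ge0 => y _; rewrite lee_fin sqr_ge0. Qed.

Let int_pG2 : mu.-integrable A (fun x => (p x)%:E * G2 x)%E.
Proof.
apply/integrableP; split.
  by apply: measurable_funTS; apply: emeasurable_funM => //; exact/measurable_EFinP.
rewrite (eq_integral (fun x => (p x)%:E * G2 x)%E); last first.
  by move=> x _; rewrite gee0_abs// mule_ge0 ?lee_fin.
rewrite int_pG2E; move/integrableP : int_pag2 => [_].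
rewrite (eq_integral (fun x => (p x * (a x * g x ^+ 2))%:E))// => x _.
by rewrite gee0_abs// lee_fin.
Qed.

(** The number [c] is free so that the expansion serves both for [c = g x] and for [c = - g x]. *)
Let expand_sq x c : G2 x \is a fin_num ->
  (\int[P x]_(y in A) ((c - g y) ^+ 2)%:E)%E =
  (c ^+ 2 * a x - 2 * c * G1 x + fine (G2 x))%:E.
Proof.
move=> G2fin.
have ig2 : (P x).-integrable A (EFin \o (fun y => g y ^+ 2)).
  apply/integrableP; split.
    by apply: measurable_funTS; apply/measurable_EFinP; exact: measurable_funX.
  rewrite (eq_integral (fun y => (g y ^+ 2)%:E)).
    by rewrite -/(G2 x) -ge0_fin_numE.
  move=> y _.
  by rewrite /= ger0_norm ?sqr_ge0//.
have icst (k : R) : (P x).-integrable A (EFin \o cst k).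
  apply/integrableP; split; first by apply/measurable_EFinP; exact: measurable_cst.
  by rewrite /= integral_cst// aE -EFinM ltry.
(* Under a finite measure [|g| <= g ^+ 2 + 1] makes [g] integrable once [g ^+ 2] is. *)
have ig : (P x).-integrable A (EFin \o g).
  have ig2p1 := integrableD mA ig2 (icst 1).
  apply: (le_integrable _ _ _ ig2p1) => //.
    by apply: measurable_funTS; exact/measurable_EFinP.
  move=> y _; rewrite /= lee_fin [leRHS]ger0_norm ?addr_ge0 ?sqr_ge0//.
  have := sqr_ge0 (`|g y| - 1); rewrite -[g y ^+ 2]real_normK ?num_real//.
  by have := normr_ge0 (g y); nra.
have icg : (P x).-integrable A (EFin \o (fun y => 2 * c * g y)).
  exact: (integrableZl mA (2 * c) ig).
have iB : (P x).-integrable A (EFin \o (fun y => cst (c ^+ 2) y - 2 * c * g y)).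
  exact: (integrableB mA (icst (c ^+ 2)) icg).
rewrite (_ : (fun y => ((c - g y) ^+ 2)%:E) =
  EFin \o (fun y => (cst (c ^+ 2) y - 2 * c * g y) + g y ^+ 2)); last first.
  by apply/funext => y /=; congr (_%:E); ring.
rewrite -[LHS]fineK; last first.
  apply: integrable_fin_num => //; exact: (integrableD mA iB ig2).
congr (_%:E).
rewrite -[LHS]/(Rintegral (P x) A _) RintegralD// RintegralB// Rintegral_cst//.
by rewrite RintegralZl.
Qed.

Let F x := p x * (g x * (g x - restr_op P A g x)).

Let FE x : F x = p x * (a x * g x ^+ 2 - g x * G1 x).
Proof. by rewrite /F /restr_op -/(G1 x) aC; ring. Qed.

(** Domination by [2 p a g^2 + p G2]: nonnegativity of the expanded squares for [c = g x] and
    [c = - g x] bounds [2 |g x * G1 x|] by [a x * g x ^+ 2 + G2 x]. *)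
Lemma integrable_dirichlet : mu.-integrable A (EFin \o F).
Proof.
have iB := integrableD mA int_pag2 int_pG2.
apply: (le_integrable _ _ _ (integrableD mA int_pag2 iB)) => //.
  apply: measurable_funTS; apply/measurable_EFinP.
  rewrite (_ : F = fun x => p x * (a x * g x ^+ 2 - g x * G1 x)); last exact/funext.
  apply: measurable_funM => //.
  apply: measurable_funB; apply: measurable_funM => //.
  exact: measurable_funX.
move=> x _; rewrite [leRHS]gee0_abs; last first.
  by rewrite !adde_ge0 ?mule_ge0 ?lee_fin.
rewrite /= FE.
have [->|px0] := eqVneq (p x) 0; first by rewrite !mul0r mul0e normr0 !adde0.
have px_gt0 : 0 < p x by rewrite lt_neqAle eq_sym px0 p0.
(* If [G2 x] is infinite, so is the dominating function, as [p x] is positive. *)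
have [G2fin|] := boolP (G2 x \is a fin_num); last first.
  rewrite ge0_fin_numE// -leNgt leye_eq => /eqP ->.
  by rewrite gt0_muley ?lte_fin// !addey// leey.
have h1 : 0 <= (g x) ^+ 2 * a x - 2 * g x * G1 x + fine (G2 x).
  rewrite -lee_fin -expand_sq//.
  by apply: integral_ge0 => y _; rewrite lee_fin sqr_ge0.
have h2 : 0 <= (- g x) ^+ 2 * a x - 2 * (- g x) * G1 x + fine (G2 x).
  rewrite -lee_fin -expand_sq//.
  by apply: integral_ge0 => y _; rewrite lee_fin sqr_ge0.
rewrite -[X in (_ * X)%E]fineK// -EFinM -!EFinD lee_fin -!mulrDr.
rewrite normrM (ger0_norm (p0 x)) ler_wpM2l// ler_norml.
have := fine_ge0 (G2_ge0 x).
have := mulr_ge0 (a_ge0 x) (sqr_ge0 (g x)).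
move: h1 h2; rewrite sqrrN; move: (fine _) (g x ^+ 2) => u v.
by move=> *; apply/andP; split; lra.
Qed.

(* The integral of [g ^+ 2] against [P x] is finite only for almost every [x]
   with [0 < p x]: there the square expands, and by reversibility the two square
   terms have the same integral. *)
Lemma dirichlet_sq :
  (2 * pmass mu F A)%:E = (\int[mu]_(x in A) ((p x)%:E * H x))%E.
Proof.
have i2F : mu.-integrable A (fun x => (2 * F x)%:E).
  exact: (integrableZl mA 2 integrable_dirichlet).
have ae_fin := integrable_ae mA int_pG2.
have mpH : measurable_fun A (fun x => (p x)%:E * H x)%E.
  apply: measurable_funTS; apply: emeasurable_funM; first exact/measurable_EFinP.
  exact: measurable_integral_sqB.
(* The term [p * (a * g ^+ 2)] is added on the left so that only sums occur; after integration it
   cancels against the equal and finite integral of [p * G2]. *)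
have : (\int[mu]_(x in A) ((p x)%:E * H x + (p x * (a x * g x ^+ 2))%:E) =
        \int[mu]_(x in A) ((2 * F x)%:E + (p x)%:E * G2 x))%E.
  apply: ae_eq_integral => //.
  - apply: emeasurable_funD => //; exact: (measurable_int _ int_pag2).
  - apply: emeasurable_funD; [exact: (measurable_int _ i2F)|exact: (measurable_int _ int_pG2)].
  apply: filterS ae_fin => x /= + Ax => /(_ Ax) fin; rewrite FE.
  have [->|px0] := eqVneq (p x) 0; first by rewrite !mul0r !mul0e mulr0.
  have G2fin : G2 x \is a fin_num.
    have px_gt0 : 0 < p x by rewrite lt_neqAle eq_sym px0 p0.
    rewrite ge0_fin_numE// ltey; apply/eqP => G2oo; move: fin.
    by rewrite G2oo gt0_muley// lte_fin.
  rewrite /H expand_sq// -[X in (_ = _ + _ * X)%E]fineK// -!EFinM -!EFinD.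
  by congr (_%:E); ring.
rewrite ge0_integralD//; last 3 first.
- by move=> x _; rewrite mule_ge0 ?lee_fin.
- by move=> x _; rewrite lee_fin.
- exact: (measurable_int _ int_pag2).
rewrite integralD// int_pG2E =>
  /(congr1 (fun z => z - \int[mu]_(x in A) (p x * (a x * g x ^+ 2))%:E)%E).
have fin : (\int[mu]_(x in A) (p x * (a x * g x ^+ 2))%:E)%E \is a fin_num.
  exact: integrable_fin_num.
rewrite !addeK// => ->.
rewrite -RintegralZl//; last exact: integrable_dirichlet.
by rewrite fineK//; exact: integrable_fin_num.
Qed.
End Dirichlet.

(** * Weighted square-integrable functions *)

Section RealIntegral.
Context {R : realType} {d : measure_display} {T : measurableType d}.
Variable mu : {measure set T -> \bar R}.

Lemma pmassE (f : T -> R) (A : set T) : pmass mu f A = \int[mu]_(x in A) f x.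
Proof. by []. Qed.

Lemma pmass_ge0 (f : T -> R) (A : set T) :
  (forall x, 0 <= f x) -> 0 <= pmass mu f A.
Proof. by move=> f0; apply: Rintegral_ge0 => x _. Qed.

Lemma EFin_pmass (f : T -> R) (A : set T) :
  measurable A -> mu.-integrable A (EFin \o f) ->
  (pmass mu f A)%:E = (\int[mu]_(x in A) (f x)%:E)%E.
Proof. by move=> mA If; rewrite fineK//; exact: integrable_fin_num. Qed.

Lemma integrableTS (f : T -> \bar R) (A : set T) :
  mu.-integrable [set: T] f -> measurable A -> mu.-integrable A f.
Proof. by move=> If mA; exact: integrableS If. Qed.

Lemma pmass_subset (f : T -> R) (A B : set T) :
  measurable A -> measurable B -> A `<=` B -> (forall x, 0 <= f x) ->
  mu.-integrable [set: T] (EFin \o f) -> pmass mu f A <= pmass mu f B.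
Proof.
move=> mA mB AB f0 If; rewrite -lee_fin !EFin_pmass//; try exact: integrableTS.
apply: ge0_subset_integral => //.
- exact: measurable_int (integrableTS If mB).
- by move=> x _; rewrite lee_fin.
Qed.

Lemma pmass_partition (s : seq (set T)) (D : set T) (f : T -> R) :
  is_partition mu s -> measurable D -> (forall x, 0 <= f x) ->
  mu.-integrable [set: T] (EFin \o f) ->
  pmass mu f D = \sum_(A <- s) pmass mu f (D `&` A).
Proof.
move=> part mD f0 If; apply: EFin_inj; rewrite EFin_pmass//; last exact: integrableTS.
rewrite (ge0_integral_partition part)//; last by case/integrableP: If.
rewrite -sumEFin !(big_nth set0) !big_nat; apply: eq_bigr => j /andP[_ js].
have mj : measurable (D `&` nth set0 s j).
  by apply: measurableI => //; case: part => + _ _; apply.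
by rewrite EFin_pmass//; exact: integrableTS.
Qed.

Lemma partition_measurable (s : seq (set T)) (A : set T) :
  is_partition mu s -> A \in s -> measurable A.
Proof. by move=> [ms _ _] /(nthP set0)[j js <-]; exact: ms. Qed.

Lemma integrable_rsum (I : Type) (s : seq I) (f : I -> T -> R) (A : set T) :
  measurable A -> (forall i, mu.-integrable A (EFin \o f i)) ->
  mu.-integrable A (EFin \o (fun x => \sum_(i <- s) f i x)).
Proof.
move=> mA If.
have := @integrable_sum _ _ _ mu _ mA _ s xpredT _ (fun i _ => If i).
by congr (_.-integrable _ _); apply/funext => x /=; rewrite sumEFin.
Qed.

Lemma Rintegral_sum (I : Type) (s : seq I) (f : I -> T -> R) (A : set T) :
  measurable A -> (forall i, mu.-integrable A (EFin \o f i)) ->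
  \int[mu]_(x in A) (\sum_(i <- s) f i x) = \sum_(i <- s) \int[mu]_(x in A) f i x.
Proof.
move=> mA If; elim: s => [|i s IH].
  rewrite big_nil -[RHS](mul0r (fine (mu A))) -Rintegral_cst//.
  by apply: eq_Rintegral => x _; rewrite big_nil.
rewrite big_cons -IH -RintegralD//.
  by apply: eq_Rintegral => x _; rewrite big_cons.
exact: integrable_rsum.
Qed.

(** The weight is left free because it will be a density, an overlap of two densities, or a minimum
    of two densities scaled by the level weights. *)
Definition sq_integrable (w u : T -> R) : Prop :=
  measurable_fun [set: T] u /\
  mu.-integrable [set: T] (EFin \o (fun x => w x * u x ^+ 2)).

Section Weight.
Variable w : T -> R.
Hypothesis w0 : forall x, 0 <= w x.
Hypothesis mw : measurable_fun [set: T] w.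

Lemma sq_integrable_mul (u v : T -> R) :
  sq_integrable w u -> sq_integrable w v ->
  mu.-integrable [set: T] (EFin \o (fun x => w x * (u x * v x))).
Proof.
move=> [mu_ iu] [mv iv].
apply: (le_integrable _ _ _ (integrableD measurableT iu iv)) => //.
  by apply/measurable_EFinP; apply: measurable_funM => //; exact: measurable_funM.
move=> x _ /=; rewrite lee_fin -mulrDr !(normrM (w x)) (ger0_norm (w0 x)).
rewrite ler_wpM2l// [leRHS]ger0_norm ?addr_ge0 ?sqr_ge0// ler_norml.
by apply/andP; split; nra.
Qed.

Lemma sq_integrableB (u v : T -> R) :
  sq_integrable w u -> sq_integrable w v -> sq_integrable w (fun x => u x - v x).
Proof.
move=> iu iv; have iuv := sq_integrable_mul iu iv.
case: iu iv => [mu_ iu] [mv iv]; split; first exact: measurable_funB.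
have := integrableB measurableT (integrableD measurableT iu iv)
  (integrableZl measurableT 2 iuv).
congr (_.-integrable _ _); apply/funext => x /=.
by rewrite -?EFinM -?EFinD -?EFinN -?EFinD; congr (_%:E); ring.
Qed.

Lemma sq_integrable_cst (c : R) :
  mu.-integrable [set: T] (EFin \o w) -> sq_integrable w (cst c).
Proof.
move=> iw; split; first exact: measurable_cst.
have := integrableZl measurableT (c ^+ 2) iw.
by congr (_.-integrable _ _); apply/funext => x /=; rewrite -?EFinM mulrC.
Qed.

(** This transfers square-integrability from a density to the minima built from it, which a multiple
    of the density dominates. *)
Lemma sq_integrable_le (c : R) (w' u : T -> R) :
  (forall x, w x <= c * w' x) -> sq_integrable w' u -> sq_integrable w u.
Proof.
move=> ww' [mu_ iu]; split => //.
apply: (le_integrable _ _ _ (integrableZl measurableT c iu)) => //.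
  by apply/measurable_EFinP; apply: measurable_funM => //; exact: measurable_funX.
move=> x _ /=; rewrite lee_fin ger0_norm; last exact: mulr_ge0 (sqr_ge0 _).
by apply: (le_trans _ (ler_norm _)); rewrite (mulrA c) ler_wpM2r ?sqr_ge0.
Qed.

Lemma pmass_sqB (u : T -> R) (c : R) (D : set T) : measurable D ->
  mu.-integrable [set: T] (EFin \o w) -> sq_integrable w u ->
  pmass mu (fun x => w x * (u x - c) ^+ 2) D =
  pmass mu (fun x => w x * u x ^+ 2) D - 2 * c * pmass mu (fun x => w x * u x) D
  + c ^+ 2 * pmass mu w D.
Proof.
move=> mD iw iu.
have iwu : mu.-integrable D (EFin \o (fun x => w x * u x)).
  have := integrableTS (sq_integrable_mul iu (sq_integrable_cst 1 iw)) mD.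
  by congr (_.-integrable _ _); apply/funext => x /=; rewrite mulr1.
have iD := integrableTS iw mD.
have iu2 := integrableTS iu.2 mD.
rewrite !pmassE -(RintegralZl (2 * c) mD iwu) -(RintegralZl (c ^+ 2) mD iD).
rewrite -RintegralB//; last exact: (integrableZl mD (2 * c) iwu).
rewrite -RintegralD//; last 2 first.
- exact: (integrableB mD iu2 (integrableZl mD (2 * c) iwu)).
- exact: (integrableZl mD (c ^+ 2) iD).
by apply: eq_Rintegral => x _; ring.
Qed.

End Weight.

End RealIntegral.

(** * Gaps of restricted chains *)

Section SingleChain.
Context {R : realType} {d : measure_display} {T : measurableType d}.
Variable mu : {measure set T -> \bar R}.
Variables (p : T -> R) (P : R.-pker T ~> T).
Hypothesis densp : is_density mu p.
Hypothesis revP : reversible mu p P.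

Let p0 x : 0 <= p x. Proof. by case: densp. Qed.
Let mp : measurable_fun [set: T] p. Proof. by case: densp. Qed.

Lemma integrable_density : mu.-integrable [set: T] (EFin \o p).
Proof.
case: densp => _ _ p1; apply/integrableP; split; first exact/measurable_EFinP.
rewrite (eq_integral (EFin \o p)) ?p1 ?ltry// => x _.
by rewrite gee0_abs ?lee_fin.
Qed.

Lemma pmass_densityT : pmass mu p [set: T] = 1.
Proof. by case: densp => _ _; rewrite /pmass => ->. Qed.

(** The form of the restricted chain before division by [p(A)]: in this normalisation the forms of
    different blocks can be added. *)
Definition dirichlet_form (A : set T) (g : T -> R) : R :=
  pmass mu (fun x => p x * (g x * (g x - restr_op P A g x))) A.

Let sqint_lty g : sq_integrable mu p g -> (\int[mu]_x (p x * g x ^+ 2)%:E < +oo)%E.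
Proof.
by move=> [_ ig]; rewrite ltey_eq; apply/orP; left; exact: integrable_fin_num.
Qed.

Lemma dirichlet_form_ge0 (A : set T) (g : T -> R) :
  measurable A -> sq_integrable mu p g -> 0 <= dirichlet_form A g.
Proof.
move=> mA sg; have [mg _] := sg.
rewrite -(pmulr_rge0 _ (ltr0Sn R 1)) -lee_fin (dirichlet_sq p0 mp revP mg (sqint_lty sg) mA).
apply: integral_ge0 => x _; rewrite mule_ge0 ?lee_fin//.
by apply: integral_ge0 => y _; rewrite lee_fin sqr_ge0.
Qed.

(** Written with squared differences, the block forms count only the pairs of points lying in one
    block, while the full form counts all pairs. *)
Lemma dirichlet_form_partition (s : seq (set T)) (g : T -> R) :
  is_partition mu s -> sq_integrable mu p g ->
  \sum_(A <- s) dirichlet_form A g <= dirichlet_form [set: T] g.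
Proof.
move=> part sg; have [mg _] := sg; have g2 := sqint_lty sg.
rewrite -(ler_pM2l (ltr0Sn R 1)) -lee_fin (dirichlet_sq p0 mp revP mg g2 measurableT).
have mH A : measurable A -> measurable_fun [set: T]
    (fun x => (p x)%:E * \int[P x]_(y in A) ((g x - g y) ^+ 2)%:E)%E.
  move=> mA; apply: emeasurable_funM; first exact/measurable_EFinP.
  exact: measurable_integral_sqB.
have H0 A x : (0 <= (p x)%:E * \int[P x]_(y in A) ((g x - g y) ^+ 2)%:E)%E.
  rewrite mule_ge0 ?lee_fin//.
  by apply: integral_ge0 => y _; rewrite lee_fin sqr_ge0.
rewrite (ge0_integral_partition part)//; last exact: mH.
rewrite mulr_sumr -sumEFin big_seq [leRHS]big_seq; apply: lee_sum => A As.
have mA := partition_measurable part As.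
rewrite (dirichlet_sq p0 mp revP mg g2 mA) setTI; apply: ge0_le_integral => //.
- by apply: measurable_funTS; exact: mH.
- by apply: measurable_funTS; exact: mH.
move=> x _; apply: lee_wpmul2l; first by rewrite lee_fin.
apply: ge0_subset_integral => //; last by move=> y _; rewrite lee_fin sqr_ge0.
apply/measurable_EFinP; apply: measurable_funX; exact: measurable_funB.
Qed.

(** With positive variance this is the infimum tested on [g], the factor [1 / p(A)] cancelling; with
    zero variance [g] is no test function and the bound is nonnegativity of the form. *)
Lemma gap_restr_poincare (A : set T) (g : T -> R) (c : R) :
  measurable A -> sq_integrable mu p g -> 0 < pmass mu p A ->
  (c%:E <= gap_restr mu p P A)%E ->
  c * pmass mu (fun x => p x * (g x - meanA mu p A g) ^+ 2) A <= dirichlet_form A g.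
Proof.
move=> mA sg pA0 cgap; have [mg ig] := sg.
set V := pmass _ _ _.
have V0 : 0 <= V.
  by apply: pmass_ge0 => x; exact: mulr_ge0 (p0 x) (sqr_ge0 _).
have [V_eq0|V_neq0] := eqVneq V 0.
  by rewrite V_eq0 mulr0 dirichlet_form_ge0.
have varE : varA mu p A g = V / pmass mu p A by [].
have var0 : 0 < varA mu p A g by rewrite varE divr_gt0// lt_neqAle eq_sym V_neq0.
have : (c%:E <= (dirichletA mu p P A g / varA mu p A g)%:E)%E.
  apply: (le_trans cgap); apply: ereal_inf_lbound; exists g => //; split => //.
  split; first exact: measurable_funTS.
  apply: le_lt_trans (sqint_lty sg); apply: ge0_subset_integral => //.
  - by case/integrableP : ig.
  - by move=> x _; rewrite lee_fin; exact: mulr_ge0 (p0 x) (sqr_ge0 _).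
rewrite lee_fin ler_pdivlMr// varE /dirichletA -/(dirichlet_form A g).
by rewrite mulrA ler_pM2r ?invr_gt0.
Qed.

Lemma pmass_gt0 (C : set T) :
  measurable C -> (forall x, C x -> 0 < p x) -> (0 < mu C)%E -> 0 < pmass mu p C.
Proof.
move=> mC Cp muC; rewrite lt_neqAle pmass_ge0// andbT eq_sym.
apply/eqP => pC0; move: muC.
suff -> : mu C = 0%E by rewrite ltxx.
have iC := integrableTS integrable_density mC.
have : (\int[mu]_(x in C) `|(p x)%:E| = 0)%E.
  rewrite (eq_integral (EFin \o p)); first by rewrite -EFin_pmass// pC0.
  by move=> x _; rewrite gee0_abs ?lee_fin.
move/(ae_eq_integral_abs mu mC (measurable_int mu iC)).1.
move=> [N [mN N0 sub]]; apply: (subset_measure0 mC mN _ N0) => x Cx; apply: sub => /=.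
move=> /(_ Cx)[px0]; by have := Cp x Cx; rewrite px0 ltxx.
Qed.

(* The bound [1/2] makes [p(B) <= 2 p(B) (1 - p(B))], twice the variance of [\1_B]. *)
Lemma atomless_split : atomless mu ->
  exists B, [/\ measurable B, 0 < pmass mu p B & pmass mu p B <= 2^-1].
Proof.
move=> atml.
pose S := [set x | 0 < p x].
have mS : measurable S.
  have := mp measurableT (measurable_itv `]0, +oo[).
  by congr (measurable _); rewrite setTI; apply/seteqP; split => x /=;
    rewrite in_itv/= andbT.
have muS : (0 < mu S)%E.
  rewrite lt_neqAle measure_ge0 andbT; apply/eqP => /esym muS0.
  have := pmass_densityT; rewrite pmassE Rintegral_mkcond.
  rewrite (_ : p \_ setT = p \_ S); last first.
    apply/funext => x; rewrite !patchE in_setT; case: ifPn => //.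
    rewrite notin_setE /S /= => /negP; rewrite -leNgt => px.
    by apply/eqP; rewrite eq_le px p0.
  rewrite -Rintegral_mkcond /Rintegral null_set_integral//.
    by move/esym/eqP; rewrite oner_eq0.
  by apply: measurable_funTS; exact/measurable_EFinP.
(* The set of positive density is cut into two parts of positive measure, so both [B] and its
   complement get positive mass. *)
have [B [mB BS muB muBS]] := atml S mS muS.
have muSB : (0 < mu (S `\` B))%E.
  rewrite lt_neqAle measure_ge0 andbT; apply/eqP => /esym SB0.
  move: muBS; rewrite -(setDUK BS) measureU//; last 2 first.
  - exact: measurableD.
  - by rewrite -subset0 => x [? []].
  by rewrite [X in (_ + X)%E]SB0 adde0 ltxx.
have pB : 0 < pmass mu p B by apply: pmass_gt0 => // x /BS.
have mCB := measurableC mB.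
have pCB : 0 < pmass mu p (~` B).
  apply: (@lt_le_trans _ _ (pmass mu p (S `\` B))).
    by apply: pmass_gt0 => //; [exact: measurableD|move=> x []].
  apply: pmass_subset => //; [exact: measurableD|exact: integrable_density].
have sum1 : pmass mu p B + pmass mu p (~` B) = 1.
  rewrite -pmass_densityT !pmassE -Rintegral_setU// ?setUv//.
    exact: integrable_density.
  by apply/disj_setPS; rewrite setICr.
(* The two masses add up to [1], so one of the two sets has mass at most [1/2]. *)
have [Ble|Bgt] := leP (pmass mu p B) 2^-1; first by exists B.
exists (~` B); split => //.
by move: Bgt sum1; move: (pmass mu p B) (pmass _ _ _) => u v; lra.
Qed.

(** The test function is [\1_B] with [b = p(B) <= 1/2]: its Dirichlet form is at most [b], since the
    kernel keeps it nonnegative, and its variance [b - b ^+ 2] is at least [b / 2]. *)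
Lemma gap_restr_setT_le2 : atomless mu -> (gap_restr mu p P [set: T] <= 2%:E)%E.
Proof.
move=> /atomless_split[B [mB b_gt0 b_le]].
set b := pmass mu p B in b_gt0 b_le.
have mI : measurable_fun [set: T] (\1_B : T -> R) by exact: measurable_indic.
have pIE : (fun x => p x * \1_B x) = p \_ B by rewrite patch_indic.
have I2 x : (\1_B x : R) ^+ 2 = \1_B x.
  by rewrite indicE; case: (_ \in _); rewrite ?expr1n ?expr0n.
have pI2 : (fun x => p x * \1_B x ^+ 2) = (fun x => p x * \1_B x).
  by apply/funext => x; rewrite I2.
have mass_pI : pmass mu (fun x => p x * \1_B x) [set: T] = b.
  by rewrite pIE pmassE -Rintegral_mkcond.
have ipI : mu.-integrable [set: T] (EFin \o (fun x => p x * \1_B x)).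
  apply: (le_integrable _ _ _ integrable_density) => //.
    by apply/measurable_EFinP; exact: measurable_funM.
  move=> x _ /=; rewrite lee_fin normrM ler_piMr// indicE.
  by case: (_ \in _); rewrite ?normr1 ?normr0 ?ler01.
have sI : sq_integrable mu p \1_B by split => //; rewrite pI2.
have varE : varA mu p [set: T] \1_B = b - b ^+ 2.
  rewrite /varA /meanA pmass_densityT !divr1 mass_pI.
  rewrite (pmass_sqB p0 mp b measurableT integrable_density sI) pI2 mass_pI.
  by rewrite pmass_densityT; ring.
have var0 : 0 < varA mu p [set: T] \1_B by rewrite varE; nra.
have dirE : dirichletA mu p P [set: T] \1_B <= b.
  rewrite /dirichletA pmass_densityT divr1 -mass_pI.
  apply: le_Rintegral => //.
    exact: (integrable_dirichlet p0 mp revP mI (sqint_lty sI) measurableT).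
  move=> x _; apply: ler_wpM2l => //.
  have restr0 : 0 <= restr_op P [set: T] \1_B x.
    apply: addr_ge0; last by apply: mulr_ge0 => //; exact: fine_ge0.
    by apply/fine_ge0/integral_ge0 => y _; rewrite lee_fin.
  rewrite mulrBr -expr2 I2 gerBl; exact: mulr_ge0.
have gapP : [set g | inL2A mu p [set: T] g /\ 0 < varA mu p [set: T] g] (\1_B : T -> R).
  by split => //; split => //; exact: sqint_lty.
apply: le_trans (ereal_inf_lbound (ex_intro2 _ _ _ gapP erefl)) _.
rewrite lee_fin ler_pdivrMr//; apply: (le_trans dirE); rewrite varE.
by nra.
Qed.
End SingleChain.

(** * Overlaps of consecutive levels *)

Section TwoLevels.
Context {R : realType} {d : measure_display} {T : measurableType d}.
Variable mu : {measure set T -> \bar R}.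
Variables (p1 p2 : T -> R).
Hypothesis dens1 : is_density mu p1.
Hypothesis dens2 : is_density mu p2.

Let q x := Num.min (p1 x) (p2 x).

Let p10 x : 0 <= p1 x. Proof. by case: dens1. Qed.
Let p20 x : 0 <= p2 x. Proof. by case: dens2. Qed.
Let q0 x : 0 <= q x. Proof. by rewrite le_min p10 p20. Qed.
Let qle1 x : q x <= 1 * p1 x. Proof. by rewrite mul1r ge_min lexx. Qed.
Let qle2 x : q x <= 1 * p2 x. Proof. by rewrite mul1r ge_min lexx orbT. Qed.
Let mp1 : measurable_fun [set: T] p1. Proof. by case: dens1. Qed.
Let mp2 : measurable_fun [set: T] p2. Proof. by case: dens2. Qed.
Let mq : measurable_fun [set: T] q. Proof. exact: measurable_minr. Qed.

Lemma integrable_overlap : mu.-integrable [set: T] (EFin \o q).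
Proof.
apply: (le_integrable _ _ _ (integrable_density dens1)) => //.
  exact/measurable_EFinP.
by move=> x _; rewrite !gee0_abs ?lee_fin//=; have := qle1 x; rewrite mul1r.
Qed.

(** At every point [m2 - m1] is [(g2 - g1) - (g2 - m2) + (g1 - m1)]. The inequality
    [(u - v + w)^2 <= 3 (u^2 + v^2 + w^2)] is integrated against [q] over the common part; then
    weights and domains are enlarged. *)
Lemma overlap_step (g1 g2 : T -> R) (A B : set T) (m1 m2 : R) :
  sq_integrable mu p1 g1 -> sq_integrable mu p2 g2 ->
  measurable A -> measurable B ->
  pmass mu q (A `&` B) * (m2 - m1) ^+ 2 <=
  3 * (pmass mu (fun x => p2 x * (g2 x - m2) ^+ 2) A +
       pmass mu (fun x => q x * (g2 x - g1 x) ^+ 2) [set: T] +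
       pmass mu (fun x => p1 x * (g1 x - m1) ^+ 2) B).
Proof.
move=> s1 s2 mA mB; have mAB : measurable (A `&` B) by exact: measurableI.
have iq := integrable_overlap.
have c1 := sq_integrable_cst m1 (integrable_density dens1).
have c2 := sq_integrable_cst m2 (integrable_density dens2).
have sB1 := sq_integrableB p10 mp1 s1 c1.
have sB2 := sq_integrableB p20 mp2 s2 c2.
have q1 := sq_integrable_le q0 mq qle1 s1.
have q2 := sq_integrable_le q0 mq qle2 s2.
have qB1 := sq_integrable_le q0 mq qle1 sB1.
have qB2 := sq_integrable_le q0 mq qle2 sB2.
have q12 := sq_integrableB q0 mq q2 q1.
have wsq0 (w u : T -> R) : (forall x, 0 <= w x) -> forall x, 0 <= w x * u x ^+ 2.
  by move=> w0 x; exact: mulr_ge0 (w0 x) (sqr_ge0 _).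
have iS u : sq_integrable mu q u ->
    mu.-integrable (A `&` B) (EFin \o (fun x => q x * u x ^+ 2)).
  by move=> [_ iu]; exact: integrableTS.
have step (w u : T -> R) D : (forall x, q x <= 1 * w x) -> A `&` B `<=` D -> measurable D ->
    sq_integrable mu q u -> sq_integrable mu w u ->
    pmass mu (fun x => q x * u x ^+ 2) (A `&` B) <= pmass mu (fun x => w x * u x ^+ 2) D.
  move=> qw AD mD squ swu.
  have w0 x : 0 <= w x by rewrite -[w x]mul1r (le_trans (q0 x)).
  apply: (@le_trans _ _ (pmass mu (fun x => w x * u x ^+ 2) (A `&` B))).
    apply: le_Rintegral => //; [exact: iS|exact: integrableTS swu.2 _|].
    by move=> x _; rewrite ler_wpM2r ?sqr_ge0//; have := qw x; rewrite mul1r.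
  by apply: pmass_subset => //; [exact: wsq0|exact: swu.2].
have S2 := step _ _ A qle2 (@subIsetl _ A B) mA qB2 sB2.
have S1 := step _ _ B qle1 (@subIsetr _ A B) mB qB1 sB1.
have S0 : pmass mu (fun x => q x * (g2 x - g1 x) ^+ 2) (A `&` B) <=
          pmass mu (fun x => q x * (g2 x - g1 x) ^+ 2) [set: T].
  by apply: pmass_subset => //; [exact: wsq0|exact: q12.2].
apply: (@le_trans _ _ (3 * (pmass mu (fun x => q x * (g2 x - m2) ^+ 2) (A `&` B) +
       pmass mu (fun x => q x * (g2 x - g1 x) ^+ 2) (A `&` B) +
       pmass mu (fun x => q x * (g1 x - m1) ^+ 2) (A `&` B)))); last first.
  by rewrite ler_wpM2l// !lerD.
have iAB : mu.-integrable (A `&` B) (EFin \o q) by exact: integrableTS.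
rewrite !pmassE -(RintegralZr _ mAB iAB).
have i2 := iS _ qB2; have i12 := iS _ q12; have i1 := iS _ qB1.
have i212 := integrableD mAB i2 i12.
rewrite -RintegralD// -RintegralD// -RintegralZl//; last exact: (integrableD mAB i212 i1).
apply: le_Rintegral => //.
- have := integrableZl mAB ((m2 - m1) ^+ 2) iAB.
  by congr (_.-integrable _ _); apply/funext => x /=; rewrite -?EFinM mulrC.
- exact: (integrableZl mAB 3 (integrableD mAB i212 i1)).
move=> x _ /=; rewrite -!mulrDr [leRHS]mulrCA ler_wpM2l//.
have e : m2 - m1 = (g2 x - g1 x) - (g2 x - m2) + (g1 x - m1) by ring.
rewrite e; move: (g2 x - g1 x) (g2 x - m2) (g1 x - m1) => u v w.
have := sqr_ge0 (u + v); have := sqr_ge0 (u - w); have := sqr_ge0 (v + w).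
by nra.
Qed.

(** Averaging: if every block fell short, summing over the partition would give [pmass mu q A < c],
    as the masses [p1(B)] add up to [1]. *)
Lemma overlap_block (s : seq (set T)) (A : set T) (c : R) :
  is_partition mu s -> measurable A -> 0 < c -> c <= pmass mu q A ->
  exists2 B, B \in s & c * pmass mu p1 B <= pmass mu q (A `&` B).
Proof.
move=> part mA c0 cA; apply: contrapT => nex.
have p1T := pmass_densityT dens1.
rewrite (pmass_partition part)// in p1T; last exact: integrable_density.
have lt B : B \in s -> pmass mu q (A `&` B) < c * pmass mu p1 B.
  by move=> Bs; rewrite ltNge; apply/negP => le; apply: nex; exists B.
have : pmass mu q A < c.
  rewrite -[ltRHS]mulr1 -p1T (pmass_partition part)//; last exact: integrable_overlap.
  (* A strict inequality between sums requires some block to exist; an empty list would give total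
     mass [0] instead of [1]. *)
  rewrite mulr_sumr big_seq [ltRHS]big_seq; apply: ltr_sum => [|B Bs].
    case: s p1T {part nex lt} => [|B s _]; last by apply/hasP; exists B; rewrite ?mem_head.
    by rewrite big_nil => /eqP; rewrite eq_sym oner_eq0.
  by rewrite setTI lt.
by rewrite ltNge cA.
Qed.
End TwoLevels.

(** * The tempering chain *)

Section Tempering.
Context {R : realType} {d : measure_display} {T : measurableType d}.
Variable mu : {measure set T -> \bar R}.
Variables (L : nat) (r : nat -> R) (p : nat -> T -> R) (P : nat -> R.-pker T ~> T).
Hypothesis dens : forall i, (i < L)%N -> is_density mu (p i).
Hypothesis rev : forall i, (i < L)%N -> reversible mu (p i) (P i).
Hypothesis r0 : forall i, (i < L)%N -> 0 < r i.
Variable g : nat -> T -> R.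
Hypothesis sg : forall k, (k < L)%N -> sq_integrable mu (p k) (g k).

Let p0 k (kL : (k < L)%N) x : 0 <= p k x. Proof. by case: (dens kL). Qed.
Let mp k (kL : (k < L)%N) : measurable_fun [set: T] (p k).
Proof. by case: (dens kL). Qed.

(** Among all constants the mean minimises the expected square deviation, so the variance may be
    measured from the mean of the bottom level. *)
Lemma st_var_le (c : R) : \sum_(k < L) r k = 1 ->
  st_var mu L r p g <=
  \sum_(k < L) r k * pmass mu (fun x => p k x * (g k x - c) ^+ 2) [set: T].
Proof.
move=> r1.
have sumE (a : R) : \sum_(k < L) r k * pmass mu (fun x => p k x * (g k x - a) ^+ 2) [set: T] =
    \sum_(k < L) r k * pmass mu (fun x => p k x * g k x ^+ 2) [set: T]
    - 2 * a * st_mean mu L r p g + a ^+ 2.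
  have -> : a ^+ 2 = \sum_(k < L) r k * a ^+ 2 by rewrite -mulr_suml r1 mul1r.
  rewrite /st_mean /st_int mulr_sumr -sumrB -big_split/=.
  apply: eq_bigr => k _; have kL := ltn_ord k.
  rewrite (pmass_sqB (p0 kL) (mp kL) a measurableT (integrable_density (dens kL)) (sg kL)).
  by rewrite (pmass_densityT (dens kL)); ring.
rewrite /st_var /st_int !sumE.
by move: (st_mean _ _ _ _ _) => m; have := sqr_ge0 (m - c); nra.
Qed.

(** Up to the factor [1 / (2 L)], this is the stationary flow of level moves from [(x, k)] to
    [(x, l)]; it is symmetric in [k] and [l]. *)
Let w (k l : nat) x := Num.min (r k * p k x) (r l * p l x).

Let w_ge0 k l (kL : (k < L)%N) (lL : (l < L)%N) x : 0 <= w k l x.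
Proof.
by rewrite le_min !mulr_ge0 ?p0// ltW ?r0.
Qed.

Let mw k l (kL : (k < L)%N) (lL : (l < L)%N) : measurable_fun [set: T] (w k l).
Proof.
apply: measurable_minr; apply: measurable_funM; do ?[exact: measurable_cst].
  exact: mp.
exact: mp.
Qed.

(* Holds also where [p k x = 0], as the quotient in [accept] is then [0]. *)
Let accept_weight k l (kL : (k < L)%N) (lL : (l < L)%N) x :
  r k * (p k x * accept r p k l x) = w k l x.
Proof.
rewrite /accept /w mulrA; have rk := r0 kL.
have [->|pk] := eqVneq (p k x) 0.
  by rewrite mulr0 mul0r min_l// mulr_ge0 ?p0// ltW ?r0.
have rp : 0 < r k * p k x by rewrite mulr_gt0// lt_neqAle eq_sym pk p0.
rewrite minr_pMr ?ltW// mulr1 mulrC divfK ?gt_eqF//.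
by rewrite minC.
Qed.

Let sw1 k l : (k < L)%N -> (l < L)%N -> sq_integrable mu (w k l) (g k).
Proof.
move=> kL lL; apply: sq_integrable_le (sg kL) => //; [exact: w_ge0|exact: mw|].
by move=> x; rewrite ge_min; apply/orP; left; exact: lexx.
Qed.

Let sw2 k l : (k < L)%N -> (l < L)%N -> sq_integrable mu (w k l) (g l).
Proof.
move=> kL lL; apply: sq_integrable_le (sg lL) => //; [exact: w_ge0|exact: mw|].
by move=> x; rewrite ge_min; apply/orP; right; exact: lexx.
Qed.

Let W k l := pmass mu (fun x => w k l x * (g k x * (g k x - g l x))) [set: T].

Let iW k l : (k < L)%N -> (l < L)%N ->
  mu.-integrable [set: T] (EFin \o (fun x => w k l x * (g k x * (g k x - g l x)))).
Proof.
move=> kL lL; apply: sq_integrable_mul; [exact: w_ge0|exact: mw|exact: sw1|].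
by apply: sq_integrableB; [exact: w_ge0|exact: mw|exact: sw1|exact: sw2].
Qed.

Let sqW k l := pmass mu (fun x => w k l x * (g k x - g l x) ^+ 2) [set: T].

Let W_sym k l : (k < L)%N -> (l < L)%N -> W k l + W l k = sqW k l.
Proof.
move=> kL lL; rewrite /W /sqW !pmassE -RintegralD//; [|exact: iW|exact: iW].
apply: eq_Rintegral => x _.
by rewrite [w l k x]minC -/(w k l x); ring.
Qed.

Let sqW_ge0 k l : (k < L)%N -> (l < L)%N -> 0 <= sqW k l.
Proof.
by move=> kL lL; apply: pmass_ge0 => x; exact: mulr_ge0 (w_ge0 kL lL x) (sqr_ge0 _).
Qed.

Lemma restr_opT (Q : R.-pker T ~> T) (f : T -> R) x :
  restr_op Q [set: T] f x = fine (\int[Q x]_y (f y)%:E)%E.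
Proof. by rewrite /restr_op setCT measure0 mulr0 addr0. Qed.

(** Type 1 moves give half of each level form. Type 2 moves give [1 / (2 L)] times the sum of the
    [W k l], and pairing [W k l] with [W l k] turns this into squares at the cost of another factor
    [1/2]. *)
Lemma st_dirichletE : (0 < L)%N ->
  st_dirichlet mu L r p P g =
  2^-1 * \sum_(k < L) r k * dirichlet_form mu (p k) (P k) [set: T] (g k) +
  (4 * L%:R)^-1 * \sum_(k < L) \sum_(l < L) sqW k l.
Proof.
move=> L0; have Ln0 : L%:R != 0 :> R by rewrite pnatr_eq0 -lt0n.
have sumW : \sum_(k < L) \sum_(l < L) sqW k l = 2 * \sum_(k < L) \sum_(l < L) W k l.
  rewrite [2 * _]mulr_natl mulr2n [X in _ = _ + X]exchange_big -big_split/=.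
  apply: eq_bigr => k _; rewrite -big_split/=; apply: eq_bigr => l _.
  by rewrite W_sym.
rewrite sumW (_ : (4 * L%:R)^-1 * _ =
  (2 * L%:R)^-1 * \sum_(k < L) \sum_(l < L) W k l); last first.
  by field.
rewrite !mulr_sumr -big_split/= /st_dirichlet /st_int; apply: eq_bigr => k _.
have kL := ltn_ord k.
have iD : mu.-integrable [set: T] (EFin \o (fun x =>
    p k x * (g k x * (g k x - restr_op (P k) [set: T] (g k) x)))).
  have [mgk igk] := sg kL.
  apply: (integrable_dirichlet (p0 kL) (mp kL) (rev kL) mgk _ measurableT).
  by rewrite ltey_eq; apply/orP; left; exact: integrable_fin_num.
have iWk (l : 'I_L) := iW kL (ltn_ord l).
have iS : mu.-integrable [set: T] (EFin \o (fun x =>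
    \sum_(l < L) w k l x * (g k x * (g k x - g l x)))).
  exact: integrable_rsum.
rewrite -/(W k _) /dirichlet_form /W !pmassE -Rintegral_sum//.
have rk0 := lt0r_neq0 (r0 kL).
rewrite (mulrCA 2^-1) -[X in _ = _ + X](mulVKf rk0) -mulrDr; congr (_ * _).
rewrite -!RintegralZl//; last exact: (integrableZl measurableT _ iS).
rewrite -RintegralD//; last 2 first.
- exact: (integrableZl measurableT _ iD).
- exact: (integrableZl measurableT _ (integrableZl measurableT _ iS)).
apply: eq_Rintegral => x _.
have -> : \sum_(l < L) w k l x * (g k x * (g k x - g l x)) =
   r k * (p k x * (g k x * \sum_(l < L) (accept r p k l x * (g k x - g l x)))).
  rewrite !mulr_sumr; apply: eq_bigr => l _.
  by rewrite -(accept_weight kL (ltn_ord l)); ring.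
rewrite restr_opT /st_op.
have -> : \sum_(l < L) (accept r p k l x * g l x + (1 - accept r p k l x) * g k x) =
   L%:R * g k x - \sum_(l < L) accept r p k l x * (g k x - g l x).
  have -> : L%:R * g k x = \sum_(l < L) g k x.
    by rewrite sumr_const card_ord mulr_natl.
  by rewrite -sumrB; apply: eq_bigr => l _; ring.
move: (fine _) (\sum_(l < L) _) => a b.
by field; rewrite Ln0 rk0.
Qed.

(** Of the level moves only those from [k] to [k.-1] are kept; the others contribute nonnegative
    terms. *)
Lemma st_dirichlet_ge (c : R) : (0 < L)%N -> 0 <= c ->
  (forall k, (k < L)%N -> c <= r k) ->
  2^-1 * \sum_(k < L) r k * dirichlet_form mu (p k) (P k) [set: T] (g k) +
  (4 * L%:R)^-1 * (c * \sum_(k < L) pmass mu (fun x =>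
     Num.min (p k.-1 x) (p k x) * (g k x - g k.-1 x) ^+ 2) [set: T])
  <= st_dirichlet mu L r p P g.
Proof.
move=> L0 c0 cr; rewrite st_dirichletE// lerD2l ler_wpM2l ?invr_ge0 ?mulr_ge0 ?ler0n//.
rewrite mulr_sumr; apply: ler_sum => k _; have kL := ltn_ord k.
have k1L : (k.-1 < L)%N by apply: leq_ltn_trans kL; exact: leq_pred.
(* For [k = 0] the predecessor is [0] itself, and the kept term vanishes with [g 0 - g 0]. *)
rewrite (bigD1 (Ordinal k1L))//= -[leLHS]addr0; apply: lerD; last first.
  by apply: sumr_ge0 => l _; exact: sqW_ge0.
have [mgB iB] : sq_integrable mu (w k k.-1) (fun x => g k x - g k.-1 x).
  by apply: sq_integrableB; [exact: w_ge0|exact: mw|exact: sw1|exact: sw2].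
have m_w x : c * Num.min (p k.-1 x) (p k x) <= w k k.-1 x.
  rewrite minr_pMr// /w le_min !ge_min; apply/andP; split; apply/orP; [right|left];
    by rewrite ler_wpM2r ?p0// cr.
have m0 x : 0 <= Num.min (p k.-1 x) (p k x) by rewrite le_min !p0.
have mm : measurable_fun [set: T] (fun x => Num.min (p k.-1 x) (p k x)).
  by apply: measurable_minr; exact: mp.
have im : mu.-integrable [set: T] (EFin \o (fun x =>
    Num.min (p k.-1 x) (p k x) * (g k x - g k.-1 x) ^+ 2)).
  have le1 x : Num.min (p k.-1 x) (p k x) <= 1 * p k.-1 x by rewrite mul1r ge_min lexx.
  have le2 x : Num.min (p k.-1 x) (p k x) <= 1 * p k x by rewrite mul1r ge_min lexx orbT.
  have s1 := sq_integrable_le m0 mm le1 (sg k1L).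
  have s2 := sq_integrable_le m0 mm le2 (sg kL).
  by have [] := sq_integrableB m0 mm s2 s1.
rewrite /sqW !pmassE -RintegralZl//; apply: le_Rintegral => //.
  exact: (integrableZl measurableT _ im).
by move=> x _; rewrite (mulrA c) ler_wpM2r ?sqr_ge0.
Qed.
End Tempering.

(** Cauchy-Schwarz in incremental form: a path of [n] links gets one more link [a]. After
    multiplication by [n] the claim reduces to [(n a - b)^2 >= 0]; for [n = 0] the hypothesis forces
    [b = 0]. *)
Lemma sqrD_le (R : realFieldType) (a b s S n : R) : 0 <= n -> 0 <= S ->
  a ^+ 2 <= s -> b ^+ 2 <= n * S -> (a + b) ^+ 2 <= (n + 1) * (S + s).
Proof.
move=> n0 S0 as_ bS; have [n_eq0|n_neq0] := eqVneq n 0.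
  move: bS; rewrite n_eq0 mul0r => bS.
  have /eqP : b ^+ 2 = 0 by apply/eqP; rewrite eq_le bS sqr_ge0.
  by rewrite sqrf_eq0 => /eqP ->; rewrite addr0 add0r mul1r; lra.
have n_gt0 : 0 < n by rewrite lt_neqAle eq_sym n_neq0.
rewrite -(ler_pM2l n_gt0).
have h1 : n * (1 + n) * a ^+ 2 <= n * (1 + n) * s by rewrite ler_wpM2l// mulr_ge0// addr_ge0.
have h2 : (1 + n) * b ^+ 2 <= (1 + n) * (n * S) by rewrite ler_wpM2l// addr_ge0.
by have := sqr_ge0 (n * a - b); nra.
Qed.

(** * Block means along paths of overlapping blocks *)

Section Blocks.
Context {R : realType} {d : measure_display} {T : measurableType d}.
Variable mu : {measure set T -> \bar R}.
Variables (L : nat) (r : nat -> R) (p : nat -> T -> R) (P : nat -> R.-pker T ~> T).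
Variable Part : nat -> seq (set T).
Hypothesis dens : forall i, (i < L)%N -> is_density mu (p i).
Hypothesis rev : forall i, (i < L)%N -> reversible mu (p i) (P i).
Hypothesis r0 : forall i, (i < L)%N -> 0 < r i.
Hypothesis r1 : \sum_(i < L) r i = 1.
Hypothesis part : forall i, (i < L)%N -> is_partition mu (Part i).
Hypothesis part0 : Part 0%N = [:: [set: T]].
Variables delta pmin : R.
Hypothesis delta0 : 0 < delta.
Hypothesis delta1 : delta <= 1.
Hypothesis pmin0 : 0 < pmin.
Hypothesis pmin1 : pmin <= 1.
Hypothesis pminP : forall i A, (i < L)%N -> A \in Part i -> pmin <= pmass mu (p i) A.
Hypothesis deltaP : forall i A, (0 < i < L)%N -> A \in Part i ->
  delta * pmass mu (p i) A <= pmass mu (fun x => Num.min (p i.-1 x) (p i x)) A.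
Variable g : nat -> T -> R.
Hypothesis sg : forall k, (k < L)%N -> sq_integrable mu (p k) (g k).

Let L0 : (0 < L)%N.
Proof.
by case: L r1 => // /eqP; rewrite big_ord0 eq_sym oner_eq0.
Qed.

Let p0 k (kL : (k < L)%N) x : 0 <= p k x. Proof. by case: (dens kL). Qed.
Let mp k (kL : (k < L)%N) : measurable_fun [set: T] (p k).
Proof. by case: (dens kL). Qed.

Let m i A := meanA mu (p i) A (g i).
Let vA i A := pmass mu (fun x => p i x * (g i x - m i A) ^+ 2) A.
Let v i := \sum_(A <- Part i) vA i A.
Let t i := pmass mu (fun x => Num.min (p i.-1 x) (p i x) * (g i x - g i.-1 x) ^+ 2) [set: T].
(** The [3] comes from splitting a difference of means into three terms, and [delta * pmin ^+ 2] is
    the guaranteed overlap of two linked blocks. *)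
Let K := 3 / (delta * pmin ^+ 2).
Let c := m 0 [set: T].

Let K0 : 0 < K.
Proof. by rewrite divr_gt0// mulr_gt0// exprn_gt0. Qed.

Let vA_ge0 i A : (i < L)%N -> 0 <= vA i A.
Proof.
by move=> iL; apply: pmass_ge0 => x; exact: mulr_ge0 (p0 iL x) (sqr_ge0 _).
Qed.

Let v_ge0 i : (i < L)%N -> 0 <= v i.
Proof. by move=> iL; apply: sumr_ge0 => A _; exact: vA_ge0. Qed.

Let predL i : (i < L)%N -> (i.-1 < L)%N.
Proof. by move=> iL; apply: leq_ltn_trans iL; exact: leq_pred. Qed.

Let t_ge0 i : (i < L)%N -> 0 <= t i.
Proof.
move=> iL; apply: pmass_ge0 => x; apply: mulr_ge0; last exact: sqr_ge0.
by rewrite le_min !p0// predL.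
Qed.

Let vA_le i A : (i < L)%N -> A \in Part i -> vA i A <= v i.
Proof.
move=> iL Ai; rewrite /v (big_rem A)//= lerDl.
by apply: sumr_ge0 => B _; exact: vA_ge0.
Qed.

(** The overlap of the two densities on [A] is at least [delta * pmin], so averaging gives a block
    [B] sharing at least [delta * pmin * p_i(B)] with [A], hence at least [delta * pmin ^+ 2]. *)
Lemma block_mean_step i A : (i.+1 < L)%N -> A \in Part i.+1 ->
  exists2 B, B \in Part i & (m i.+1 A - m i B) ^+ 2 <= K * (v i.+1 + t i.+1 + v i).
Proof.
move=> i1L Ai; have iL : (i < L)%N by exact: ltnW.
have mA := partition_measurable (part i1L) Ai.
have dp : delta * pmin <= pmass mu (fun x => Num.min (p i x) (p i.+1 x)) A.
  by apply: le_trans (deltaP _ Ai) => //; rewrite ler_pM2l// pminP.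
have [B Bi le] := overlap_block (dens iL) (dens i1L) (part iL) mA (mulr_gt0 delta0 pmin0) dp.
exists B => //; have mB := partition_measurable (part iL) Bi.
have := overlap_step (dens iL) (dens i1L) (m i B) (m i.+1 A) (sg iL) (sg i1L) mA mB.
rewrite -/(vA i.+1 A) -/(t i.+1) -/(vA i B) => step.
rewrite /K mulrAC ler_pdivlMr ?mulr_gt0 ?exprn_gt0//.
apply: (@le_trans _ _ (3 * (vA i.+1 A + t i.+1 + vA i B))); last first.
  by rewrite ler_pM2l// !lerD// vA_le.
apply: le_trans step; rewrite mulrC ler_wpM2r ?sqr_ge0//.
apply: le_trans le; rewrite expr2 mulrA ler_pM2l ?mulr_gt0//.
exact: pminP.
Qed.

(** Every block is linked to one a level below, and the path ends at the only block of level [0],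
    whose mean is [c]. *)
Lemma block_mean_path i A : (i < L)%N -> A \in Part i ->
  (m i A - c) ^+ 2 <= i%:R * \sum_(j < i) K * (v j.+1 + t j.+1 + v j).
Proof.
elim: i A => [|i IH] A iL Ai.
  by move: Ai; rewrite part0 inE => /eqP ->; rewrite subrr expr0n mul0r.
have [B Bi step] := block_mean_step iL Ai.
have {IH} := IH B (ltnW iL) Bi.
rewrite big_ord_recr/=; move: step.
set S := \sum_(j < i) _; set s := K * _; move=> step path.
have S0 : 0 <= S.
  apply: sumr_ge0 => j _; have jL : (j.+1 < L)%N.
    by apply: leq_ltn_trans iL; exact: leqW.
  by apply: mulr_ge0; rewrite ?(ltW K0)// !addr_ge0// ?v_ge0 ?t_ge0// ltnW.
rewrite (_ : m i.+1 A - c = (m i.+1 A - m i B) + (m i B - c)); last by ring.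
rewrite -natr1; apply: sqrD_le => //; exact: ler0n.
Qed.

Let V := \sum_(k < L) v k.
Let Tt := \sum_(k < L) t k.

Let sum_le (f : nat -> R) i : (forall k, (k < L)%N -> 0 <= f k) -> (i <= L)%N ->
  \sum_(j < i) f j <= \sum_(j < L) f j.
Proof.
move=> f0 iL; rewrite (big_ord_widen _ _ iL) [leRHS](bigID (fun j : 'I_L => (j < i)%N))/=.
by rewrite lerDl; apply: sumr_ge0 => j _; exact: f0.
Qed.

Let sumS_le (f : nat -> R) i : (forall k, (k < L)%N -> 0 <= f k) -> (i < L)%N ->
  \sum_(j < i) f j.+1 <= \sum_(j < L) f j.
Proof.
move=> f0 iL; apply: le_trans (sum_le f0 iL).
by rewrite big_ord_recl/= lerDr f0.
Qed.

(** Along the path each [v j] occurs at most twice, as upper and as lower end of a link, and each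
    [t j] at most once. *)
Let block_mean_le i A : (i < L)%N -> A \in Part i ->
  (m i A - c) ^+ 2 <= L%:R * (K * (2 * V + Tt)).
Proof.
move=> iL Ai; apply: le_trans (block_mean_path iL Ai) _.
rewrite -mulr_sumr !big_split/=.
have iLR : i%:R <= L%:R :> R by rewrite ler_nat ltnW.
have S1 := sumS_le v_ge0 iL; have S2 := sumS_le t_ge0 iL; have S3 := sum_le v_ge0 (ltnW iL).
apply: ler_pM => //.
  apply: mulr_ge0; rewrite ?(ltW K0)// !addr_ge0// sumr_ge0// => j _.
  - by apply: v_ge0; apply: leq_ltn_trans iL; exact: ltn_ord.
  - by apply: t_ge0; apply: leq_ltn_trans iL; exact: ltn_ord.
  - by apply: v_ge0; apply: ltn_trans iL; exact: ltn_ord.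
by rewrite ler_pM2l//; move: S1 S2 S3; rewrite -/V -/Tt; lra.
Qed.

(** The cross term vanishes because [m i A] is the mean over the block. *)
Let block_var i A : (i < L)%N -> A \in Part i ->
  pmass mu (fun x => p i x * (g i x - c) ^+ 2) A =
  vA i A + pmass mu (p i) A * (m i A - c) ^+ 2.
Proof.
move=> iL Ai; have mA := partition_measurable (part iL) Ai.
have ip := integrable_density (dens iL).
have pA : pmass mu (p i) A != 0.
  by rewrite gt_eqF// (lt_le_trans pmin0)// pminP.
rewrite /vA !(pmass_sqB (p0 iL) (mp iL) _ mA ip (sg iL)) /m /meanA.
by field.
Qed.

(** The block decompositions are summed; as the masses of the blocks add up to [1], the uniform
    bound on the means enters once. *)
Lemma level_var_le i : (i < L)%N ->
  pmass mu (fun x => p i x * (g i x - c) ^+ 2) [set: T] <=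
  v i + L%:R * (K * (2 * V + Tt)).
Proof.
move=> iL; have ip := integrable_density (dens iL).
have [_ sB] := sq_integrableB (p0 iL) (mp iL) (sg iL) (sq_integrable_cst c ip).
rewrite (pmass_partition (part iL))//; last first.
  by move=> x; exact: mulr_ge0 (p0 iL x) (sqr_ge0 _).
have -> : v i + L%:R * (K * (2 * V + Tt)) =
    \sum_(A <- Part i) (vA i A + pmass mu (p i) A * (L%:R * (K * (2 * V + Tt)))).
  rewrite big_split/= -mulr_suml; congr (_ + _).
  rewrite -[LHS]mul1r; congr (_ * _); rewrite -(pmass_densityT (dens iL)).
  rewrite (pmass_partition (part iL))//; last exact: p0.
  by apply: eq_bigr => A _; rewrite setTI.
rewrite big_seq [leRHS]big_seq; apply: ler_sum => A Ai.
rewrite setTI block_var// lerD2l ler_wpM2l ?block_mean_le//.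
by apply: pmass_ge0; exact: p0.
Qed.

(** The within-block variances are charged to the level forms [rD] and the terms [Tt] to the level
    moves [y]; [c0] stands in for the level weights where a sum over levels carries none. *)
Lemma tempering_poincare (gamma c0 : R) : 0 <= gamma -> gamma <= 2 ->
  (forall i A, (i < L)%N -> A \in Part i -> (gamma%:E <= gap_restr mu (p i) (P i) A)%E) ->
  0 < c0 -> (forall i, (i < L)%N -> c0 <= r i) ->
  c0 * (delta * pmin ^+ 2) * (gamma * st_var mu L r p g) <=
  26 * L%:R ^+ 2 * st_dirichlet mu L r p P g.
Proof.
move=> gamma0 gamma2 gammaP c00 c0P.
have D_ge i : (i < L)%N -> gamma * v i <= dirichlet_form mu (p i) (P i) [set: T] (g i).
  move=> iL; apply: le_trans (dirichlet_form_partition (dens iL) (rev iL) (part iL) (sg iL)).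
  rewrite mulr_sumr big_seq [leRHS]big_seq; apply: ler_sum => A Ai.
  apply: gap_restr_poincare => //; [exact: dens|exact: rev| |exact: sg| |exact: gammaP].
    exact: partition_measurable (part iL) Ai.
  by rewrite (lt_le_trans pmin0)// pminP.
set D := fun i => dirichlet_form mu (p i) (P i) [set: T] (g i) in D_ge.
have D0 i : (i < L)%N -> 0 <= D i.
  by move=> iL; apply: (le_trans _ (D_ge i iL)); rewrite mulr_ge0// v_ge0.
have dir := st_dirichlet_ge dens rev r0 sg L0 (ltW c00) c0P.
rewrite -/(\sum_(k < L) r k * D k) -/Tt in dir.
set E := st_dirichlet _ _ _ _ _ _ in dir *.
set rD := \sum_(k < L) r k * D k in dir.
have var_le : st_var mu L r p g <= \sum_(k < L) r k * v k + L%:R * (K * (2 * V + Tt)).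
  apply: le_trans (st_var_le dens sg c r1) _.
  rewrite -[X in _ + X]mul1r -{1}r1 mulr_suml -big_split/=; apply: ler_sum => k _.
  by rewrite -mulrDr ler_pM2l ?r0// level_var_le.
have rv_le : gamma * \sum_(k < L) r k * v k <= rD.
  rewrite mulr_sumr; apply: ler_sum => k _.
  by rewrite mulrCA ler_pM2l ?r0// D_ge.
have V_le : c0 * (gamma * V) <= rD.
  rewrite !mulr_sumr; apply: ler_sum => k _.
  apply: ler_pM; [exact: ltW|by rewrite mulr_ge0// v_ge0|exact: c0P|exact: D_ge].
have c01 : c0 <= 1.
  apply: (le_trans (c0P _ L0)); rewrite -r1 (bigD1 (Ordinal L0))//= lerDl.
  by apply: sumr_ge0 => k _; rewrite ltW// r0.
have rD0 : 0 <= rD by apply: sumr_ge0 => k _; rewrite mulr_ge0 ?D0// ltW// r0.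
have Tt0 : 0 <= Tt by apply: sumr_ge0 => k _; rewrite t_ge0.
have l1 : 1 <= L%:R :> R by rewrite ler1n.
have lE : L%:R * (4 * L%:R)^-1 = 4^-1 :> R.
  by field; rewrite pnatr_eq0 -lt0n.
have l0 : 0 <= (4 * L%:R)^-1 :> R by rewrite invr_ge0 mulr_ge0// ler0n.
have e0 : 0 < delta * pmin ^+ 2 by rewrite mulr_gt0// exprn_gt0.
have e1 : delta * pmin ^+ 2 <= 1.
  apply: mulr_ile1 => //; first exact: ltW.
    exact: exprn_ge0 (ltW pmin0).
  by apply: exprn_ile1 => //; exact: ltW.
have KE : delta * pmin ^+ 2 * K = 3 by rewrite /K mulrC divfK// gt_eqF.
set e := delta * pmin ^+ 2 in e0 e1 KE *.
set y := (4 * L%:R)^-1 * (c0 * Tt) in dir.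
have y0 : 0 <= y by rewrite mulr_ge0// mulr_ge0// ltW.
have yE : c0 * Tt = 4 * (L%:R * y) by rewrite /y [L%:R * _]mulrA lE mulrA divff ?mul1r.
(* The terms [t k] are bounded by level moves without any gap; [gamma <= 2] replaces their factor
   [gamma] by a constant. *)
have gT_le : c0 * (gamma * Tt) <= 8 * (L%:R * y).
  by rewrite mulrCA yE; have := mulr_ge0 (ler0n R L) y0; nra.
have e_rD : c0 * e * rD <= rD by rewrite ler_piMl//; apply: mulr_ile1 => //; exact: ltW.
(* Multiplying by [e] cancels the denominator of [K] and leaves the factor [3]. *)
have bound : c0 * e * (gamma * st_var mu L r p g) <=
    c0 * e * rD + 3 * L%:R * (2 * (c0 * (gamma * V)) + c0 * (gamma * Tt)).
  apply: (@le_trans _ _ (c0 * e * (rD + gamma * (L%:R * (K * (2 * V + Tt)))))).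
    rewrite ler_pM2l ?mulr_gt0//; apply: le_trans (ler_wpM2l gamma0 var_le) _.
    by rewrite mulrDr lerD2r.
  by rewrite -KE le_eqVlt; apply/orP; left; apply/eqP; ring.
apply: (le_trans bound); apply: (@le_trans _ _ (rD + 3 * L%:R * (2 * rD + 8 * (L%:R * y)))).
  by apply: lerD => //; rewrite ler_pM2l ?mulr_gt0 ?(lt_le_trans ltr01)//; lra.
have E_ge : rD <= 2 * (E - y) by move: dir; lra.
apply: (@le_trans _ _ (2 * (E - y) + 3 * L%:R * (2 * (2 * (E - y)) + 8 * (L%:R * y)))).
  by apply: lerD => //; rewrite ler_pM2l ?mulr_gt0 ?(lt_le_trans ltr01)//; lra.
have z0 : 0 <= E - y by move: E_ge; lra.
rewrite -[X in _ <= _ * X](subrK y E); move: (E - y) z0 => z z0.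
(* It remains to bound [2 z + 12 L z + 24 L^2 y]; as [1 <= L] this is at most [14 L^2 z + 24 L^2 y],
   within [26 L^2 (z + y)]. *)
have lz : z <= L%:R * z by rewrite ler_peMl.
have llz : L%:R * z <= L%:R ^+ 2 * z.
  by rewrite expr2 -mulrA ler_peMl// mulr_ge0// ler0n.
have lly : 0 <= L%:R ^+ 2 * y by rewrite mulr_ge0// exprn_ge0// ler0n.
rewrite (_ : 3 * L%:R * _ = 12 * (L%:R * z) + 24 * (L%:R ^+ 2 * y)); last by ring.
rewrite (_ : 26 * _ * _ = 26 * (L%:R ^+ 2 * z) + 26 * (L%:R ^+ 2 * y)); last by ring.
by move: lz llz lly z0; lra.
Qed.
End Blocks.

(** * Passage to the stated constant *)

Unset Implicit Arguments.

Theorem mainTheorem1 (R : realType) (d : measure_display) (T : measurableType d)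
  (mu : {measure set T -> \bar R})
  (L : nat) (r : nat -> R) (p : nat -> T -> R) (P : nat -> R.-pker T ~> T)
  (Part : nat -> seq (set T)) :
  sigma_finite [set: T] mu ->
  atomless mu ->
  (forall i, (i < L)%N -> is_density mu (p i)) ->
  (forall i, (i < L)%N -> stationary mu (p i) (P i)) ->
  (forall i, (i < L)%N -> reversible mu (p i) (P i)) ->
  (forall i, (i < L)%N -> 0 < r i) ->
  \sum_(i < L) r i = 1 ->
  (forall i, (i < L)%N -> is_partition mu (Part i)) ->
  (forall i, (i < L)%N -> forall j, (j < size (Part i))%N ->
     0 < pmass mu (p i) (nth set0 (Part i) j)) ->
  Part 0%N = [:: [set: T]] ->
  let rr := \big[Num.min/r 0%N]_(i < L) r i / \big[Num.max/r 0%N]_(i < L) r i in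
  let delta := \big[Num.min/1]_(1 <= i < L) \big[Num.min/1]_(A <- Part i)
        (pmass mu (fun x => Num.min (p i.-1 x) (p i x)) A / pmass mu (p i) A) in
  let pmin := \big[Num.min/1]_(i < L) \big[Num.min/1]_(A <- Part i)
        pmass mu (p i) A in
  (((rr ^+ 4 * delta ^+ 2 * pmin ^+ 2) / (32 * L%:R ^+ 4))%:E *
     \big[mine/+oo%E]_(i < L) \big[mine/+oo%E]_(A <- Part i)
        gap_restr mu (p i) (P i) A
   <= gap_st mu L r p P)%E.
Proof.
move=> _ atml dens _ rev r0 r1 part pos part0; cbv zeta.
set rmin := \big[Num.min/r 0%N]_(i < L) r i.
set rmax := \big[Num.max/r 0%N]_(i < L) r i.
set rr := rmin / rmax.
set delta := \big[Num.min/1]_(1 <= i < L) _.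
set pmin := \big[Num.min/1]_(i < L) _.
set gam := (X in (_ * X <= _)%E).
have L0 : (0 < L)%N.
  rewrite lt0n; apply/eqP => L_eq0; move: r1; rewrite big1; last by case=> i; rewrite L_eq0.
  by move/esym/eqP; rewrite oner_eq0.
have l1 : 1 <= L%:R :> R by rewrite ler1n.
have l0 : 0 < L%:R :> R by rewrite ltr0n.
have posA i A : (i < L)%N -> A \in Part i -> 0 < pmass mu (p i) A.
  by move=> iL /(nthP set0)[j js <-]; exact: pos.
have rmin0 : 0 < rmin by apply: lt_bigmin => [|i _]; exact: r0.
have rminP i : (i < L)%N -> rmin <= r i.
  by move=> iL; exact: (bigmin_le _ (Ordinal iL) (fun i : 'I_L => r i)).
have rmaxP i : (i < L)%N -> r i <= rmax.
  by move=> iL; exact: (le_bigmax _ (fun i : 'I_L => r i) (Ordinal iL)).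
have rmax_ge : 1 <= L%:R * rmax.
  have : \sum_(i < L) r i <= \sum_(i < L) rmax by apply: ler_sum => i _; exact: rmaxP.
  by rewrite r1 sumr_const card_ord mulr_natl.
have rmin_max : rmin <= rmax by apply: (le_trans (rminP _ L0)); exact: rmaxP.
have rmax0 : 0 < rmax by exact: lt_le_trans rmin_max.
have rr0 : 0 < rr by exact: divr_gt0.
have rr1 : rr <= 1 by rewrite ler_pdivrMr// mul1r.
(* The weights sum to [1], so [rmax >= 1 / L]; thus [rmin] can be exchanged for [rr] at the cost of
   a factor [L]. *)
have rr_le : rr <= L%:R * rmin.
  rewrite ler_pdivrMr// mulrAC -[leLHS]mul1r; apply: ler_wpM2r rmax_ge; exact: ltW.
have q_ge0 i (iL : (i < L)%N) A : 0 <= pmass mu (fun x => Num.min (p i.-1 x) (p i x)) A.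
  apply: pmass_ge0 => x; have [pi0 _ _] := dens i iL.
  have [pi1 _ _] := dens i.-1 (leq_ltn_trans (leq_pred i) iL).
  by rewrite le_min pi0 pi1.
(* The starting value [1] of the iterated minimum gives the bound. The true ratios are at most [1]
   as well, so it decides the value only when [L = 1] leaves no ratios. *)
have delta1 : delta <= 1 by exact: bigmin_le_id.
have delta_ge0 : 0 <= delta.
  rewrite /delta big_nat; apply: le_bigmin => // i /andP[_ iL].
  rewrite big_seq; apply: le_bigmin => // A Ai.
  by rewrite divr_ge0 ?q_ge0// ltW// posA.
have deltaP i A : (0 < i < L)%N -> A \in Part i ->
    delta * pmass mu (p i) A <= pmass mu (fun x => Num.min (p i.-1 x) (p i x)) A.
  move=> iL Ai; rewrite -ler_pdivlMr ?posA//; last by case/andP: iL.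
  apply: (@bigmin_inf_seq _ _ _ _ _ i) => //; first by rewrite mem_index_iota.
  exact: ge_bigmin_seq Ai _.
have pmin1 : pmin <= 1 by exact: bigmin_le_id.
have pmin0 : 0 < pmin.
  apply: lt_bigmin => // i _; rewrite big_seq; apply: lt_bigmin => // A Ai.
  exact: posA.
have pminP i A : (i < L)%N -> A \in Part i -> pmin <= pmass mu (p i) A.
  move=> iL Ai; apply: (bigmin_inf (Ordinal iL)) => //.
  exact: ge_bigmin_seq Ai _.
have gamP i A : (i < L)%N -> A \in Part i -> (gam <= gap_restr mu (p i) (P i) A)%E.
  move=> iL Ai; apply: (bigmin_inf (Ordinal iL)) => //.
  exact: ge_bigmin_seq Ai _.
(* The only block of the bottom level is the whole space, so the minimum is at most the gap of the
   unrestricted bottom chain. *)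
have gam2 : (gam <= 2%:E)%E.
  apply: (le_trans (gamP 0%N [set: T] L0 _)); first by rewrite part0 mem_head.
  exact: (gap_restr_setT_le2 (dens 0%N L0) (rev 0%N L0) atml).
apply: le_ereal_inf_tmp => _ [g [gL2 var0] <-].
have sg k : (k < L)%N -> sq_integrable mu (p k) (g k).
  move=> kL; have [mgk gk2] := gL2 k kL; have [pk0 mpk _] := dens k kL.
  by split => //; exact: (integrable_density_sq pk0 mpk mgk gk2 measurableT).
set E := st_dirichlet _ _ _ _ _ _.
have E0 : 0 <= E.
  have := st_dirichlet_ge dens rev r0 sg L0 (lexx 0) (fun k kL => ltW (r0 k kL)).
  apply: le_trans; rewrite mul0r mulr0 addr0 mulr_ge0// sumr_ge0// => k _.
  by rewrite mulr_ge0 ?(ltW (r0 _ _))//; apply: dirichlet_form_ge0 => //;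
    [exact: dens|exact: rev|exact: sg].
have EV0 : (0 <= (E / st_var mu L r p g)%:E)%E by rewrite lee_fin divr_ge0// ltW.
set C := rr ^+ 4 * _ * _ / _.
(* With [delta = 0], or below with a nonpositive minimal gap, the left side is at most [0] and the
   quotient on the right is nonnegative. *)
have [delta_eq0|delta_neq0] := eqVneq delta 0.
  by rewrite /C delta_eq0 expr0n mulr0 !mul0r mul0e.
have delta0 : 0 < delta by rewrite lt_neqAle eq_sym delta_neq0.
have den0 : 0 < 32 * L%:R ^+ 4 :> R by apply: mulr_gt0 => //; exact: exprn_gt0.
have C0 : 0 < C.
  by apply: divr_gt0 => //; apply: mulr_gt0; [apply: mulr_gt0|]; exact: exprn_gt0.
have [gam_le0|gam_gt0] := leP gam 0%E.
  by apply: le_trans EV0; rewrite mule_ge0_le0// lee_fin ltW.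
have : gam \is a fin_num.
  by rewrite ge0_fin_numE ?ltW// (le_lt_trans gam2)// ltry.
case/fin_numP => _ _; move: gam gam2 gam_gt0 gamP => [gamma||]//.
rewrite !lee_fin lte_fin => gamma2 gamma0 gammaP.
have main := tempering_poincare dens rev r0 r1 part part0 delta0 delta1 pmin0 pmin1
  pminP deltaP sg (ltW gamma0) gamma2 gammaP rmin0 rminP.
rewrite -?EFinM ?lee_fin ler_pdivlMr// -(mulrA C).
set X := gamma * _ in main *; have X0 : 0 < X by rewrite mulr_gt0.
rewrite -/E in main; rewrite /C mulrAC ler_pdivrMr//.
(* The argument yields the first powers of [rr] and [delta]; both numbers are at most [1], so the
   stated higher powers are smaller. *)
have coef : rr ^+ 4 * delta ^+ 2 * pmin ^+ 2 <= rr * (delta * pmin ^+ 2).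
  rewrite [leRHS]mulrA ler_pM2r ?exprn_gt0//; apply: ler_pM.
  - by rewrite exprn_ge0// ltW.
  - by rewrite exprn_ge0// ltW.
  - by rewrite exprS ler_piMr ?(ltW rr0)// exprn_ile1 ?(ltW rr0).
  - by rewrite expr2 ler_piMr// ltW.
apply: (@le_trans _ _ (rr * (delta * pmin ^+ 2) * X)); first by rewrite ler_pM2r.
apply: (@le_trans _ _ (L%:R * (rmin * (delta * pmin ^+ 2) * X))).
  by rewrite !mulrA !ler_pM2r ?exprn_gt0.
apply: (le_trans (ler_wpM2l (ltW l0) main)).
(* The factor [L] from [rr_le] turns [26 L^2] into [26 L^3], and [26 L^3 <= 32 L^4]. *)
rewrite (_ : L%:R * _ = E * (26 * L%:R ^+ 3)); last by ring.
apply: ler_wpM2l => //.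
have l3 : 0 <= L%:R ^+ 3 :> R by rewrite exprn_ge0// ltW.
have : L%:R ^+ 3 <= L%:R ^+ 4 :> R by rewrite [leRHS]exprS ler_peMl.
by move: l3; lra.
Qed.
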